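(* Let $k$ be an algebraically closed field of characteristic zero and let $f(x)\in k[x]$ be a monic polynomial of degree $3$ with no multiple roots; after the unique change of variable $x\mapsto x-b$ ($b\in k$) killing the $x^2$ coefficient, assume $f(x)=x^3+B_0x+C_0$. Let $N$ be an integer with $\gcd(N,3)=1$ and $N\ne 2,4$, let $C_{f,N}$ be the smooth projective curve with affine model $y^N=f(x)$, fix a primitive $2N$-th root of unity $\xi_{2N}\in k$, put $\xi_N=\xi_{2N}^2$, let $\omega\in k$ be a primitive cube root of unity, and let $\delta_N$ be the automorphism $(x,y)\mapsto(x,\xi_N y)$. Let $H$ be the normalizer of $\langle\delta_N\rangle$ in $\mathrm{Aut}(C_{f,N})$. Then: if $B_0C_0\ne 0$, then $H=\langle\delta_N\rangle\cong\mathbb{Z}/N\mathbb{Z}$; if $B_0=0$ and $C_0\ne 0$, then $H\cong\mathbb{Z}/3N\mathbb{Z}$, generated by $(x,y)\mapsto(\omega x,\xi_N y)$; if $B_0\ne 0$ and $C_0=0$, then $H\cong\mathbb{Z}/2N\mathbb{Z}$, generated by $(x,y)\mapsto(-x,\xi_{2N}y)$.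
   Context: $\mathrm{Aut}(C_{f,N})$ is the full automorphism group of the curve over $k$.
   Formalization: The integer N is assumed to be at least 2: for N = 1 the curve is the projective line, δ_1 is the identity and H is all of PGL_2(k), so the claim fails, and for negative N the equation y^N = f(x) and ''primitive 2N-th root'' are not meaningful. *)

(* Defs.v *)
From HB Require Import structures.
From mathcomp Require Import all_boot all_order all_algebra all_field.
From mathcomp Require Import boolp classical_sets cardinality.
Set Implicit Arguments.
Unset Strict Implicit.
Unset Printing Implicit Defensive.
Import Order.TTheory GRing.Theory Num.Theory.
Local Open Scope classical_set_scope.
Local Open Scope ring_scope.

(* The nonsingular projective curve with function field K over the
   algebraically closed field k, as in Hartshorne, Algebraic Geometry, I.6:
   its points are the discrete valuation rings of K/k, its proper closed sets
   are the finite sets of points, and the ring of regular functions on an open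
   set U is the intersection of the local rings of the points of U, an element
   of this ring being seen as a k-valued function on U by means of the residue
   fields, which are all equal to k. *)
Section NonsingularCurve.
Variables (k : closedFieldType) (K : fieldType) (iota : {rmorphism k -> K}).

(* The value of v at 0 is irrelevant. *)
Definition discrete_valuation (v : K -> int) : Prop :=
  [/\ forall a b, a != 0 -> b != 0 -> v (a * b) = v a + v b,
      forall a b, a != 0 -> b != 0 -> a + b != 0 ->
        Num.min (v a) (v b) <= v (a + b),
      forall c, c != 0 -> v (iota c) = 0
    & exists2 t, t != 0 & v t = 1].

Definition valuation_ring (v : K -> int) : set K :=
  [set z | z = 0 \/ 0 <= v z].

Definition is_dvr (R : set K) : Prop :=
  exists2 v, discrete_valuation v & R = valuation_ring v.

Record curve : Type := Point { local_ring : set K; _ : is_dvr local_ring }.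

Definition maximal_ideal (P : curve) : set K :=
  [set z | local_ring P z /\ ~ (exists2 w, local_ring P w & z * w = 1)].

(* z is regular at P, with value c in the residue field k *)
Definition has_value (P : curve) (z : K) (c : k) : Prop :=
  maximal_ideal P (z - iota c).

Definition open_set (U : set curve) : Prop := U = set0 \/ finite_set (~` U).

Definition regular (U : set curve) (g : curve -> k) : Prop :=
  exists z : K, forall P, U P -> has_value P z (g P).

Definition is_morphism (phi : curve -> curve) : Prop :=
  (forall V, open_set V -> open_set (phi @^-1` V)) /\
  (forall V g, open_set V -> regular V g -> regular (phi @^-1` V) (g \o phi)).

Record curve_aut : Type := CurveAut {
  aut_fun :> curve -> curve;
  aut_inv : curve -> curve;
  aut_funK : cancel aut_fun aut_inv;
  aut_invK : cancel aut_inv aut_fun;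
  aut_fun_morphism : is_morphism aut_fun;
  aut_inv_morphism : is_morphism aut_inv
}.

Lemma curve_autP (s t : curve_aut) : s =1 t -> s = t.
Proof.
case: s t => f f' fK f'K fm f'm [g g' gK g'K gm g'm] /= /funext fg.
move: fK f'K fm; rewrite fg => fK f'K fm.
have fg' : f' = g' by apply/funext => P; rewrite -[P in LHS]g'K fK.
move: fK f'K f'm; rewrite fg' => fK f'K f'm.
by congr CurveAut; apply: Prop_irrelevance.
Qed.

Lemma is_morphism_id : is_morphism id.
Proof. by []. Qed.

Lemma is_morphism_comp phi psi :
  is_morphism phi -> is_morphism psi -> is_morphism (phi \o psi).
Proof.
move=> [phiC phiR] [psiC psiR]; split=> [V /phiC /psiC //|V g oV rg].
exact: psiR (phiC _ oV) (phiR _ _ oV rg).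
Qed.

Definition curve_aut_one : curve_aut :=
  @CurveAut id id (frefl id) (frefl id) is_morphism_id is_morphism_id.

Definition curve_aut_inv (s : curve_aut) : curve_aut :=
  CurveAut (aut_invK s) (aut_funK s) (aut_inv_morphism s) (aut_fun_morphism s).

Definition curve_aut_mul (s t : curve_aut) : curve_aut :=
  CurveAut (can_comp (aut_funK s) (aut_funK t))
           (can_comp (aut_invK t) (aut_invK s))
           (is_morphism_comp (aut_fun_morphism s) (aut_fun_morphism t))
           (is_morphism_comp (aut_inv_morphism t) (aut_inv_morphism s)).

Lemma curve_aut_mulA : associative curve_aut_mul.
Proof. by move=> s t u; apply: curve_autP. Qed.

Lemma curve_aut_mul1 : left_id curve_aut_one curve_aut_mul.
Proof. by move=> s; apply: curve_autP. Qed.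

Lemma curve_aut_mulr1 : right_id curve_aut_one curve_aut_mul.
Proof. by move=> s; apply: curve_autP. Qed.

Lemma curve_aut_mulV : left_inverse curve_aut_one curve_aut_inv curve_aut_mul.
Proof. by move=> s; apply: curve_autP => P /=; rewrite aut_funK. Qed.

Lemma curve_aut_mulrV : right_inverse curve_aut_one curve_aut_inv curve_aut_mul.
Proof. by move=> s; apply: curve_autP => P /=; rewrite aut_invK. Qed.

HB.instance Definition _ := gen_eqMixin curve_aut.
HB.instance Definition _ := gen_choiceMixin curve_aut.
HB.instance Definition _ := isGroup.Build curve_aut
  curve_aut_mulA curve_aut_mul1 curve_aut_mulr1 curve_aut_mulV curve_aut_mulrV.

End NonsingularCurve.

(* MathComp's subgroups live in finite groups only. *)
Section Groups.
Variable G : groupType.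
Local Open Scope group_scope.

Definition cyclic_subgroup (g : G) : set G :=
  [set h | exists n : nat, h = g ^+ n \/ h = g ^- n].

Definition normalizer (A : set G) : set G :=
  [set g | (fun a => a ^ g) @` A = A].

(* 'Z_n is the ring of integers modulo n only for n > 1. *)
Definition isom_Zmod (n : nat) (A : set G) : Prop :=
  exists F : 'Z_n -> G,
    [/\ injective F, forall a b, F (a + b)%R = F a * F b & range F = A].

End Groups.

(* k[x][y] / (y^N - f(x)), for f : {poly k} and N > 0; for N = 0 the modulus is
   constant and the library quotients by 'X instead. *)
Notation coordinate_ring f N := {poly %/ ('X^N - f%:P)}.

Section Superelliptic.
Variables (k : closedFieldType) (f : {poly k}) (N : nat) (K : fieldType).
Variable j : {rmorphism coordinate_ring f N -> K}.

(* K is the field of fractions of the coordinate ring *)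
Definition is_fraction_field : Prop :=
  injective j /\ forall z : K, exists a b, b != 0 /\ z = j a / j b.

Definition base_emb : {rmorphism k -> K} :=
  j \o @qpolyC {poly k} ('X^N - f%:P) \o polyC.

Definition coord_x : K := j (@qpolyC {poly k} ('X^N - f%:P) 'X).
Definition coord_y : K := j (@qpolyX {poly k} ('X^N - f%:P)).

(* s is (x, y) |-> (a x, b y) on the affine model *)
Definition diagonal_action (a b : k) (s : curve_aut base_emb) : Prop :=
  forall (P : curve base_emb) (c d : k),
    has_value P coord_x c -> has_value P coord_y d ->
    has_value (s P) coord_x (a * c) /\ has_value (s P) coord_y (b * d).

End Superelliptic.

Notation superelliptic_aut j := (curve_aut (base_emb j)).

(* Main.v *)
Require Import Defs.
From HB Require Import structures.
From mathcomp Require Import all_boot all_order all_algebra all_field.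
From mathcomp Require Import boolp classical_sets cardinality.
From mathcomp Require Import ring zify.
Set Implicit Arguments.
Unset Strict Implicit.
Unset Printing Implicit Defensive.
Import Order.TTheory GRing.Theory Num.Theory.
Local Open Scope classical_set_scope.
Local Open Scope ring_scope.

(* The automorphisms of the curve are the k-automorphisms of its function field
   K = k(x, y): a morphism pulls regular functions back, every nonzero element
   of K is regular and nonzero at all but finitely many points, and a point is
   determined by the values of x and y there (there is a single point at which
   x has no value).  Let s* be the pull-back by an element s of the normalizer.
   As s^-1 <delta> s = <delta>, the element s*(x) is fixed by delta* and s*(y)
   is an eigenvector of delta*, so s*(x) = L(x) and s*(y) = g(x) y^i with L and
   g in k(x); the same argument for s^-1 shows that L has degree one.  Comparing
   orders modulo N in f(L) = g^N f^i: a simple zero of f(L) has to be a root of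
   f, with i = 1, while a finite pole of L would be a root of f with i = -3
   modulo N, which would force N to divide 4.  Hence L is affine, permutes the
   roots of f, whose sum is 0, and so L = a x and s*(y) = b y with
   b^N f(x) = f(a x). *)

(** * Values of functions at points *)

(** The curve is given only through its points and its regular functions, so the pull-back on K has
    to be rebuilt from values at points. Regularity yields a mere map; that it is a field morphism
    is checked point by point, which is conclusive because the curve is infinite. Infinitely many
    points exist because every solution (c, d) of d^N = f(c) is realised by exactly one valuation
    ring: the simple roots of f and N != 0 in k provide a local parameter there. The remaining place
    is unique because N is coprime to 3, so that the terms of a function have distinct pole orders.

    The three groups are read off b^N f(x) = f(a x), that is b^N = a^3, B0 a = a^3 B0 and C0 = a^3
    C0. Hence a = 1 if B0 C0 != 0, a^3 = 1 if B0 = 0 and a^2 = 1 if C0 = 0. The pairs (a, b) form a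
    cyclic group in the second case because 3 is coprime to N, and in the third because the N-th
    power of the primitive 2N-th root of unity is -1. Conversely, diagonal automorphisms commute
    with delta. *)

Section Valuations.
Variables (k : closedFieldType) (K : fieldType) (iota : {rmorphism k -> K}).

Section OneValuation.
Variable v : K -> int.
Hypothesis v_dv : discrete_valuation iota v.

Lemma valuationM a b : a != 0 -> b != 0 -> v (a * b) = v a + v b.
Proof. by case: v_dv => + _ _ _; apply. Qed.

Lemma valuationD a b : a != 0 -> b != 0 -> a + b != 0 ->
  Num.min (v a) (v b) <= v (a + b).
Proof. by case: v_dv => _ + _ _; apply. Qed.

Lemma valuation_cst c : c != 0 -> v (iota c) = 0.
Proof. by case: v_dv => _ _ + _; apply. Qed.

Lemma valuation1 : v 1 = 0.
Proof. by rewrite -(rmorph1 iota) valuation_cst ?oner_eq0. Qed.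

Lemma valuationV a : a != 0 -> v a^-1 = - v a.
Proof.
move=> a0; apply/eqP; rewrite -subr_eq0 opprK -valuationM ?invr_eq0 // mulVf //.
by rewrite valuation1.
Qed.

Lemma valuationN a : a != 0 -> v (- a) = v a.
Proof.
move=> a0; rewrite -mulN1r valuationM ?oppr_eq0 ?oner_eq0 //.
by rewrite -(rmorphN1 iota) valuation_cst ?add0r // oppr_eq0 oner_eq0.
Qed.

Lemma valuationX a n : a != 0 -> v (a ^+ n) = v a *+ n.
Proof.
move=> a0; elim: n => [|n IHn]; first by rewrite expr0 valuation1.
by rewrite exprS valuationM ?expf_neq0 // IHn mulrS.
Qed.

Definition val_ge (n : int) (z : K) : Prop := z = 0 \/ n <= v z.

Lemma val_geD n a b : val_ge n a -> val_ge n b -> val_ge n (a + b).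
Proof.
have [-> _|a0] := eqVneq a 0; first by rewrite add0r.
have [-> + _|b0] := eqVneq b 0; first by rewrite addr0.
have [->|ab0] := eqVneq (a + b) 0; first by left.
move=> [/eqP|na]; first by rewrite (negPf a0).
move=> [/eqP|nb]; first by rewrite (negPf b0).
by right; apply: le_trans (valuationD a0 b0 ab0); rewrite le_min na nb.
Qed.

Lemma val_geM m n a b : val_ge m a -> val_ge n b -> val_ge (m + n) (a * b).
Proof.
have [-> _ _|a0] := eqVneq a 0; first by rewrite mul0r; left.
have [-> _ _|b0] := eqVneq b 0; first by rewrite mulr0; left.
move=> [/eqP|na]; first by rewrite (negPf a0).
move=> [/eqP|nb]; first by rewrite (negPf b0).
by right; rewrite valuationM // lerD.
Qed.

Lemma val_geN n a : val_ge n a -> val_ge n (- a).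
Proof.
have [->|a0] := eqVneq a 0; first by rewrite oppr0.
by move=> [/eqP|na]; [rewrite (negPf a0) | right; rewrite valuationN].
Qed.

Lemma val_geW m n a : m <= n -> val_ge n a -> val_ge m a.
Proof. by move=> mn [->|na]; [left | right; apply: le_trans na]. Qed.

Lemma val_ge_cst c : val_ge 0 (iota c).
Proof.
by have [->|c0] := eqVneq c 0; [left; rewrite rmorph0 | right; rewrite valuation_cst].
Qed.

Lemma val_gt_cst c : val_ge 1 (iota c) -> c = 0.
Proof.
have [//|c0] := eqVneq c 0; move=> [/eqP|]; first by rewrite fmorph_eq0 => /eqP.
by rewrite valuation_cst.
Qed.

Lemma val_ge_sum n I (r : seq I) (P : pred I) (F : I -> K) :
  (forall i, P i -> val_ge n (F i)) -> val_ge n (\sum_(i <- r | P i) F i).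
Proof. by move=> ge_F; elim/big_ind: _ => //; [left | apply: val_geD]. Qed.

(** Otherwise a = (a + b) - b would have order at least v a + 1. This isolates dominant terms at the
    point at infinity. *)
Lemma valuation_addl a b : a != 0 -> val_ge (v a + 1) b -> a + b != 0 /\ v (a + b) = v a.
Proof.
move=> a0 ge_b; have Nge : ~ val_ge (v a + 1) a.
  by move=> [/eqP|]; [rewrite (negPf a0) | rewrite gerDl].
have ab0 : a + b != 0.
  apply/eqP=> ab0; apply: Nge.
  by rewrite -[X in val_ge _ X]opprK (addr0_eq ab0); apply: val_geN.
split=> //; apply/eqP; rewrite eq_le; apply/andP; split; last first.
  have : val_ge (v a) (a + b).
    by apply: val_geD; [right | apply: val_geW ge_b; rewrite lerDl].
  by move=> [/eqP|//]; rewrite (negPf ab0).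
rewrite leNgt; apply/negP=> lt_v; apply: Nge.
rewrite -[X in val_ge _ X](addrK b); apply: val_geD; last exact: val_geN.
by right; rewrite lezD1.
Qed.

End OneValuation.

Lemma pointP (P : curve iota) :
  exists2 v, discrete_valuation iota v & local_ring P = valuation_ring v.
Proof. by case: P. Qed.

Lemma point_ext (P Q : curve iota) : local_ring P = local_ring Q -> P = Q.
Proof.
case: P Q => R dR [S dS] /= eRS; rewrite eRS in dR *.
by congr Point; apply: Prop_irrelevance.
Qed.

Lemma maximal_idealE (P : curve iota) v z : discrete_valuation iota v ->
  local_ring P = valuation_ring v -> maximal_ideal P z <-> val_ge v 1 z.
Proof.
move=> dv Pv; rewrite /maximal_ideal Pv /=; split.
  move=> [zP zU]; have [->|z0] := eqVneq z 0; first by left.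
  case: zP => [z_eq0|vz]; first by left.
  right; rewrite -gtz0_ge1 lt_neqAle vz andbT; apply/eqP => v0; apply: zU.
  by exists z^-1; [right; rewrite (valuationV dv) // -v0 oppr0 | rewrite mulfV].
move=> zm; split; first exact: (val_geW _ zm).
case=> w w_ge0 zw1; have /(val_gt_cst dv)/eqP : val_ge v 1 (iota 1).
  by rewrite rmorph1 -zw1 -[1%R]addr0; apply: val_geM w_ge0.
by rewrite oner_eq0.
Qed.

Lemma has_valueE (P : curve iota) v z c : discrete_valuation iota v ->
  local_ring P = valuation_ring v -> has_value P z c <-> val_ge v 1 (z - iota c).
Proof. exact: maximal_idealE. Qed.

Lemma has_value_ge0 v z c : discrete_valuation iota v ->
  val_ge v 1 (z - iota c) -> val_ge v 0 z.
Proof.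
move=> dv zc; rewrite -[z](subrK (iota c)); apply: val_geD => //.
  exact: val_geW zc.
exact: val_ge_cst.
Qed.

Variable P : curve iota.
Implicit Types (z w : K) (c d : k).

Lemma has_value_cst c : has_value P (iota c) c.
Proof.
have [v dv Pv] := pointP P; apply/(has_valueE _ _ dv Pv).
by rewrite subrr; left.
Qed.

Lemma has_value_uniq z c d : has_value P z c -> has_value P z d -> c = d.
Proof.
have [v dv Pv] := pointP P => /(has_valueE _ _ dv Pv) zc /(has_valueE _ _ dv Pv) zd.
apply/eqP; rewrite -subr_eq0; apply/eqP/(val_gt_cst dv); rewrite rmorphB.
rewrite [_ - _](_ : _ = (z - iota d) + - (z - iota c)); last first.
  by ring.
by apply: val_geD => //; apply: val_geN.
Qed.

Lemma has_valueD z w c d :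
  has_value P z c -> has_value P w d -> has_value P (z + w) (c + d).
Proof.
have [v dv Pv] := pointP P => /(has_valueE _ _ dv Pv) zc /(has_valueE _ _ dv Pv) wd.
apply/(has_valueE _ _ dv Pv); rewrite rmorphD opprD addrACA.
exact: val_geD.
Qed.

Lemma has_valueM z w c d :
  has_value P z c -> has_value P w d -> has_value P (z * w) (c * d).
Proof.
have [v dv Pv] := pointP P => /(has_valueE _ _ dv Pv) zc /(has_valueE _ _ dv Pv) wd.
apply/(has_valueE _ _ dv Pv); rewrite rmorphM.
rewrite [_ - _](_ : _ = (z - iota c) * w + iota c * (w - iota d)); last first.
  by rewrite mulrBl mulrBr addrA subrK.
apply: val_geD => //.
  by rewrite -[1]addr0; apply: val_geM => //; apply: has_value_ge0 wd.
by rewrite -[1]add0r; apply: val_geM => //; apply: val_ge_cst.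
Qed.

Lemma has_valueN z c : has_value P z c -> has_value P (- z) (- c).
Proof.
rewrite -[- z]mulN1r -[- c]mulN1r -(rmorphN1 iota); apply: has_valueM.
exact: has_value_cst.
Qed.

Lemma has_valueB z w c d :
  has_value P z c -> has_value P w d -> has_value P (z - w) (c - d).
Proof. by move=> zc /has_valueN; apply: has_valueD. Qed.

Lemma has_valueX z c n : has_value P z c -> has_value P (z ^+ n) (c ^+ n).
Proof.
move=> zc; elim: n => [|n IHn]; last by rewrite !exprS; apply: has_valueM.
by rewrite !expr0 -(rmorph1 iota); apply: has_value_cst.
Qed.

Lemma has_value_local z c : has_value P z c -> local_ring P z.
Proof.
have [v dv Pv] := pointP P => /(has_valueE _ _ dv Pv) zc.
by rewrite Pv; apply: has_value_ge0 zc.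
Qed.

Lemma has_value_neq0 z c : c != 0 -> has_value P z c -> z != 0.
Proof.
move=> c0 zc; apply: contra_neqN c0 => /eqP z0; apply: has_value_uniq zc _.
by rewrite z0 -(rmorph0 iota); apply: has_value_cst.
Qed.

(** If z had positive order, so would the constant c = z - (z - c). Hence z is a unit at P, and 1/z
    - 1/c = -(z - c) / (z c). *)
Lemma has_valueV z c : c != 0 -> has_value P z c -> has_value P z^-1 c^-1.
Proof.
move=> c0 zc; have z0 := has_value_neq0 c0 zc; move: zc.
have [v dv Pv] := pointP P => /(has_valueE _ _ dv Pv) zc.
have vz : v z = 0.
  have [/eqP|vz] := has_value_ge0 dv zc; first by rewrite (negPf z0).
  apply/eqP; rewrite eq_le vz andbT leNgt; apply/negP => v_gt0.
  move/eqP: c0; apply; apply: (val_gt_cst dv); rewrite -[iota c]opprK.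
  rewrite -[- iota c](addKr z); apply: val_geN => //; apply: val_geD => //.
  by apply: val_geN => //; right.
apply/(has_valueE _ _ dv Pv).
rewrite [_ - _](_ : _ = - (z - iota c) * (z^-1 * iota c^-1)); last first.
  rewrite opprB mulrBl mulrCA -rmorphM mulfV // rmorph1 mulr1.
  by rewrite mulrA mulfV // mul1r.
rewrite -[1]addr0; apply: val_geM => //; first exact: val_geN.
rewrite -[0]addr0; apply: val_geM => //; last exact: val_ge_cst.
by right; rewrite (valuationV dv) // vz oppr0.
Qed.

Lemma has_value_horner (p : {poly k}) z c :
  has_value P z c -> has_value P (map_poly iota p).[z] p.[c].
Proof.
move=> zc; elim/poly_ind: p => [|p d IHp].
  by rewrite rmorph0 !horner0 -(rmorph0 iota); apply: has_value_cst.
rewrite rmorphD rmorphM /= map_polyX map_polyC /= !hornerE.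
by apply: has_valueD; [apply: has_valueM | apply: has_value_cst].
Qed.

End Valuations.

(** * Pull-backs *)

Section CurveAutomorphisms.
Variables (k : closedFieldType) (K : fieldType) (iota : {rmorphism k -> K}).

Section OfFieldAutomorphism.
Variables s t : K -> K.
Hypotheses (sD : {morph s : a b / a + b}) (sM : {morph s : a b / a * b}).
Hypotheses (s_iota : forall c, s (iota c) = iota c).
Hypotheses (sK : cancel s t) (tK : cancel t s).

Lemma field_aut0 : s 0 = 0.
Proof. by rewrite -(rmorph0 iota) s_iota. Qed.

Lemma field_aut1 : s 1 = 1.
Proof. by rewrite -(rmorph1 iota) s_iota. Qed.

Lemma field_aut_eq0 z : s z = 0 -> z = 0.
Proof. by rewrite -{1}field_aut0 => /(can_inj sK). Qed.

Lemma field_aut_neq0 z : z != 0 -> s z != 0.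
Proof. by apply: contra_neq => /field_aut_eq0. Qed.

Lemma is_dvr_preimage (R : set K) : is_dvr iota R -> is_dvr iota (s @^-1` R).
Proof.
move=> [v dv ->]; exists (v \o s).
  split=> [a b a0 b0|a b a0 b0 ab0|c c0|] /=.
  - by rewrite sM (valuationM dv) ?field_aut_neq0.
  - by rewrite sD; apply: (valuationD dv); rewrite -?sD field_aut_neq0.
  - by rewrite s_iota (valuation_cst dv).
  - case: dv => _ _ _ [u u0 vu]; exists (t u); last by rewrite /= tK.
    by apply: contra_neq u0 => tu; rewrite -[u]tK tu field_aut0.
apply/seteqP; split=> z [sz|vsz]; try by right.
  by left; apply: field_aut_eq0.
by left; rewrite sz; exact: field_aut0.
Qed.

Lemma field_aut_has_value : exists2 phi : curve iota -> curve iota,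
  forall P, local_ring (phi P) = s @^-1` (local_ring P) &
  forall P z c, has_value (phi P) z c <-> has_value P (s z) c.
Proof.
pose phi P := Point (is_dvr_preimage
  (match P as P' return is_dvr iota (local_ring P') with Point _ h => h end)).
exists phi => // P z c; rewrite /has_value /maximal_ideal /=.
have -> : s z - iota c = s (z - iota c).
  by rewrite sD -(rmorphN iota) s_iota rmorphN.
split=> -[zP zU]; split=> // -[w wP zw]; apply: zU.
  exists (t w); first by rewrite /= tK.
  by apply: (can_inj sK); rewrite sM tK zw field_aut1.
by exists (s w) => //; rewrite -sM zw field_aut1.
Qed.

End OfFieldAutomorphism.

(** Since the proper closed sets are the finite ones, bijectivity alone gives continuity; [s] serves
    for the regular functions. *)
Lemma is_morphism_pullback (phi psi : curve iota -> curve iota) (s : K -> K) :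
  cancel phi psi -> cancel psi phi ->
  (forall P z c, has_value (phi P) z c <-> has_value P (s z) c) ->
  is_morphism phi.
Proof.
move=> phiK psiK phi_s; split.
  move=> V [->|Vfin]; first by left; rewrite preimage_set0.
  right; rewrite preimage_setC; apply: sub_finite_set (finite_image psi Vfin).
  by move=> P /= VP; exists (phi P).
move=> V g oV [z gz]; exists (s z) => P VP /=.
by apply/phi_s; apply: gz.
Qed.

Lemma curve_aut_of_field_aut (s t : K -> K) :
    {morph s : a b / a + b} -> {morph s : a b / a * b} ->
    (forall c, s (iota c) = iota c) -> cancel s t -> cancel t s ->
  exists phi : curve_aut iota,
    forall P z c, has_value (phi P) z c <-> has_value P (s z) c.
Proof.
move=> sD sM s_iota sK tK.
have tD : {morph t : a b / a + b} by move=> a b; rewrite -{1}[a]tK -{1}[b]tK -sD sK.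
have tM : {morph t : a b / a * b} by move=> a b; rewrite -{1}[a]tK -{1}[b]tK -sM sK.
have t_iota c : t (iota c) = iota c by rewrite -[in LHS]s_iota sK.
have [phi phiR phi_s] := field_aut_has_value sD sM s_iota sK tK.
have [psi psiR psi_t] := field_aut_has_value tD tM t_iota tK sK.
have phiK : cancel phi psi.
  move=> P; apply: point_ext; rewrite psiR phiR; apply/seteqP.
  by split=> z /=; rewrite tK.
have psiK : cancel psi phi.
  move=> P; apply: point_ext; rewrite phiR psiR; apply/seteqP.
  by split=> z /=; rewrite sK.
by exists (CurveAut phiK psiK (is_morphism_pullback phiK psiK phi_s)
  (is_morphism_pullback psiK phiK psi_t)).
Qed.

(** * From automorphisms of the curve to automorphisms of its function field *)

Section Pullback.
Hypothesis cofinite_value : forall z : K, z != 0 ->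
  finite_set [set P : curve iota | ~ exists2 c : k, c != 0 & has_value P z c].
Hypothesis infinite_curve : infinite_set [set: curve iota].

(** A nonzero z - w would have a nonzero value at all but finitely many points, and the infinite
    curve has a point left outside S and these. *)
Lemma eq_of_values (z w : K) (S : set (curve iota)) : finite_set S ->
  (forall P, ~ S P -> exists2 c, has_value P z c & has_value P w c) -> z = w.
Proof.
move=> finS eqS; apply/eqP; rewrite -subr_eq0; apply/eqP/eqP.
apply: contraPT isT => zw0 _.
have finT := cofinite_value zw0.
apply: infinite_curve; apply: sub_finite_set (_ : finite_set (S `|`
  [set P : curve iota | ~ exists2 c : k, c != 0 & has_value P (z - w) c])).
  move=> P _; have [SP|nSP] := pselect (S P); [by left | right].
  move=> [c c0 Pc]; have [d zd wd] := eqS P nSP.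
  have := has_value_uniq Pc (has_valueB zd wd); rewrite subrr => c_eq0.
  by rewrite c_eq0 eqxx in c0.
by rewrite finite_setU.
Qed.

Lemma finite_no_value (z : K) :
  finite_set [set P : curve iota | ~ exists c, has_value P z c].
Proof.
have [->|z0] := eqVneq z 0.
  apply: sub_finite_set (finite_set0 _) => P []; exists 0.
  by rewrite -(rmorph0 iota); apply: has_value_cst.
apply: sub_finite_set (cofinite_value z0) => P NP [c _ Pc].
by apply: NP; exists c.
Qed.

Definition is_pullback (phi : curve iota -> curve iota) (s : K -> K) :=
  forall P z c, has_value (phi P) z c <-> has_value P (s z) c.

(** Regularity of the composite gives values of [s z] only above the points where z has one. That
    [s z] has no further values needs the inverse automorphism. *)
Lemma half_pullback (phi : curve_aut iota) :
  exists s : K -> K, forall P z c, has_value (phi P) z c -> has_value P (s z) c.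
Proof.
suff /choice [s sP] : forall z : K, exists w : K, forall P c,
    has_value (phi P) z c -> has_value P w c by exists s => P z; apply: sP.
move=> z; pose V := [set P : curve iota | exists c, has_value P z c].
have oV : open_set V by right; apply: finite_no_value.
(* The default 0 is taken only outside V, where [regular V g] asks nothing. *)
pose g (P : curve iota) : k := xget 0 [set c | has_value P z c].
have gP P c : has_value P z c -> has_value P z (g P).
  by move=> Pc; rewrite /g; case: xgetP => [_ _ //|/(_ c)].
have [w wP] : regular (phi @^-1` V) (g \o phi).
  by apply: (aut_fun_morphism phi).2 => //; exists z => P [c /gP].
exists w => P c Pc; rewrite (has_value_uniq Pc (gP _ _ Pc)).
by apply: wP; exists c.
Qed.

Lemma finite_preimage_aut (phi : curve_aut iota) (S : set (curve iota)) :
  finite_set S -> finite_set (phi @^-1` S).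
Proof.
move=> /(finite_image (aut_inv phi)); apply: sub_finite_set => P SP.
by exists (phi P) => //; apply: aut_funK.
Qed.

(** The half pull-backs s of phi and t of its inverse satisfy t (s z) = z, as both sides agree
    wherever z has a value. So a value of [s z] at P is carried by t to a value of z at [phi P]. *)
Lemma exists_pullback (phi : curve_aut iota) :
  exists s : K -> K, is_pullback phi s.
Proof.
have [s sP] := half_pullback phi.
have [t tP] := half_pullback (phi^-1)%g.
exists s => P z c; split=> [/sP //|Pc].
suff -> : z = t (s z).
  by apply: tP; rewrite /= (_ : aut_inv phi (phi P) = P) // aut_funK.
apply: (eq_of_values (finite_no_value z)) => Q /contrapT [d Qd].
exists d => //; apply: tP => /=; apply: sP.
by rewrite (aut_invK phi).
Qed.

(** Identities about a pull-back are thus tested off a finite set only; the points whose image gives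
    no value to z may be discarded as well. *)
Lemma pullback_unique (phi : curve_aut iota) s z w (S : set (curve iota)) :
  is_pullback phi s -> finite_set S ->
  (forall P c, ~ S P -> has_value (phi P) z c -> has_value P w c) -> s z = w.
Proof.
move=> sP finS wP.
apply: (@eq_of_values _ _ (S `|` phi @^-1` [set P | ~ exists c, has_value P z c])).
  rewrite finite_setU; split=> //.
  exact: finite_preimage_aut (finite_no_value z).
move=> P /not_orP[nSP /contrapT [c Pc]]; exists c; first exact/sP.
exact: wP.
Qed.

Lemma pullback_cst (phi : curve_aut iota) s c : is_pullback phi s ->
  s (iota c) = iota c.
Proof.
move=> sP; apply: (pullback_unique sP (finite_set0 _)) => P d _ /has_value_uniq e.
by rewrite (e c); apply: has_value_cst.
Qed.

Lemma pullbackD (phi : curve_aut iota) s : is_pullback phi s ->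
  {morph s : a b / a + b}.
Proof.
move=> sP a b; pose S := phi @^-1` [set P | ~ exists c, has_value P a c]
  `|` phi @^-1` [set P | ~ exists c, has_value P b c].
have finS : finite_set S.
  by rewrite finite_setU; split; apply: finite_preimage_aut (finite_no_value _).
apply: (pullback_unique sP finS) => P c /not_orP[/contrapT[d Pd] /contrapT[e Pe]].
move=> Pc; rewrite (has_value_uniq Pc (has_valueD Pd Pe)).
by apply: has_valueD; apply/sP.
Qed.

Lemma pullbackM (phi : curve_aut iota) s : is_pullback phi s ->
  {morph s : a b / a * b}.
Proof.
move=> sP a b; pose S := phi @^-1` [set P | ~ exists c, has_value P a c]
  `|` phi @^-1` [set P | ~ exists c, has_value P b c].
have finS : finite_set S.
  by rewrite finite_setU; split; apply: finite_preimage_aut (finite_no_value _).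
apply: (pullback_unique sP finS) => P c /not_orP[/contrapT[d Pd] /contrapT[e Pe]].
move=> Pc; rewrite (has_value_uniq Pc (has_valueM Pd Pe)).
by apply: has_valueM; apply/sP.
Qed.

(** The product is composition of maps, so the order is reversed on functions. *)
Lemma pullback_comp (phi psi : curve_aut iota) s t :
  is_pullback phi s -> is_pullback psi t -> is_pullback (phi * psi)%g (t \o s).
Proof. by move=> sP tP P z c /=; rewrite sP tP. Qed.

Lemma pullback_eq (phi : curve_aut iota) s t z :
  is_pullback phi s -> is_pullback phi t -> s z = t z.
Proof.
move=> sP tP; apply: (pullback_unique sP (finite_set0 _)) => P c _.
by move/tP.
Qed.

End Pullback.

End CurveAutomorphisms.

(** * Points of the superelliptic curve *)

Section CoordinateRing.
Variables (k : closedFieldType) (f : {poly k}) (N : nat) (K : fieldType).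
Variable j : {rmorphism coordinate_ring f N -> K}.
Hypotheses (N_gt0 : (0 < N)%N) (K_frac : is_fraction_field j).

Local Notation h := ('X^N - f%:P).
Local Notation x := (coord_x j).
Local Notation y := (coord_y j).
Local Notation iota := (base_emb j).

Implicit Types (Q R : {poly {poly k}}) (p : {poly k}).

Lemma size_equation : size h = N.+1.
Proof.
rewrite size_polyDl size_polyXn // size_polyN size_polyC ltnS.
by case: (_ != 0).
Qed.

Lemma monic_equation : h \is monic.
Proof.
rewrite monicE lead_coefDl ?lead_coefXn // size_polyXn size_polyN size_polyC.
by case: (_ != 0).
Qed.

Lemma mk_monic_equation : mk_monic h = h.
Proof. by rewrite /mk_monic size_equation ltnS N_gt0 monic_equation. Qed.

(* The function Q(x, y); the inner variable of Q stands for x. *)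
Definition fct (Q : {poly {poly k}}) : K := j (in_qpoly h Q).

HB.instance Definition _ := GRing.RMorphism.copy fct (j \o in_qpoly h).

Lemma fct_equation : fct h = 0.
Proof.
rewrite /fct /= [in_qpoly _ _](_ : _ = 0) ?rmorph0 //; apply/val_eqP => /=.
by rewrite mk_monic_equation Pdiv.RingMonic.rmodpp // monic_equation.
Qed.

Lemma fct_eq0 Q : fct Q = 0 -> exists R, Q = R * h.
Proof.
rewrite /fct /= -(rmorph0 j) => /K_frac.1 /(congr1 val) /=.
rewrite mk_monic_equation => Qh; exists (Pdiv.Ring.rdivp Q h).
by rewrite {1}(Pdiv.RingMonic.rdivp_eq monic_equation Q) Qh addr0.
Qed.

Lemma fct_eq Q R : fct Q = fct R -> exists S, Q = R + S * h.
Proof.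
move/eqP; rewrite -subr_eq0 -rmorphB => /eqP/fct_eq0[S QR].
by exists S; rewrite -QR addrC subrK.
Qed.

(** This is the linear independence of 1, y, ..., y^(N-1) over k[x]. *)
Lemma fct_small_eq0 Q : (size Q <= N)%N -> fct Q = 0 -> Q = 0.
Proof.
move=> sQ /fct_eq0[R QR]; have [R0|R0] := eqVneq R 0.
  by rewrite QR R0 mul0r.
move: sQ; rewrite QR size_Mmonic ?monic_equation // size_equation addnS /=.
by move: R0; rewrite -size_poly_gt0; move: (size R) => s; clear; lia.
Qed.

Lemma fct_reduce Q : exists2 R : {poly {poly k}}, (size R <= N)%N & fct R = fct Q.
Proof.
exists (val (in_qpoly h Q)).
  by have := size_mk_monic (in_qpoly h Q); rewrite {2}mk_monic_equation size_equation.
congr (j _); apply/val_inj; rewrite /= Pdiv.Ring.rmodp_small //.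
by have := size_mk_monic (in_qpoly h Q).
Qed.

Lemma fctX : fct 'X = y.
Proof. by []. Qed.

Lemma in_qpolyC p : in_qpoly h p%:P = qpolyC h p.
Proof.
apply/val_inj; rewrite /= mk_monic_equation Pdiv.Ring.rmodp_small //.
by rewrite size_equation size_polyC ltnS; case: (_ != 0).
Qed.

Lemma fctCX : fct 'X%:P = x.
Proof. by rewrite /fct /= in_qpolyC. Qed.

Lemma fctCC c : fct c%:P%:P = iota c.
Proof. by rewrite /fct /= in_qpolyC. Qed.

(* Otherwise simplification turns iota c into j (qpolyC _ c%:P). *)
Opaque base_emb.

Lemma fct_XsubC c : fct ('X - c%:P%:P) = y - iota c.
Proof. by rewrite rmorphB /= fctCC. Qed.

Lemma curve_equation : y ^+ N = fct f%:P.
Proof.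
apply/eqP; rewrite -subr_eq0 -fctX -rmorphXn -rmorphB /=; apply/eqP.
exact: fct_equation.
Qed.

Lemma fctC p : fct p%:P = (map_poly iota p).[x].
Proof.
elim/poly_ind: p => [|p c IHp]; first by rewrite !rmorph0 horner0.
rewrite !rmorphD !rmorphM /= map_polyX map_polyC /= !hornerE -IHp.
by rewrite -fctCC fctCX.
Qed.

Lemma fct_XsubCC c : fct ('X - c%:P)%:P = x - iota c.
Proof. by rewrite fctC rmorphB /= map_polyX map_polyC !hornerE. Qed.

Lemma fctC_eq0 p : (fct p%:P == 0) = (p == 0).
Proof.
apply/eqP/eqP=> [/fct_small_eq0 e|->]; last by rewrite !rmorph0.
by apply/polyC_inj/e; apply: leq_trans (size_polyC_leq1 _) N_gt0.
Qed.

Lemma fctC_inj p q : fct p%:P = fct q%:P -> p = q.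
Proof.
move/eqP; rewrite -subr_eq0 -rmorphB -polyCB /= fctC_eq0 subr_eq0.
by move/eqP.
Qed.

(* The norm from K to k(x), as a resultant. *)
Lemma fct_norm Q : fct Q != 0 -> exists (R : {poly {poly k}}) (g : {poly k}), g != 0 /\ fct Q * fct R = fct g%:P.
Proof.
have [{}Q sQ <-] := fct_reduce Q => Q0.
have [sQ1|sQ1] := leqP (size Q) 1.
  exists 1, Q`_0; rewrite rmorph1 mulr1 -size1_polyC //; split=> //.
  by rewrite -fctC_eq0 -size1_polyC.
have sh1 : (1 < size h)%N by rewrite size_equation ltnS.
have [[U V] /= [_ _ resE]] := resultant_in_ideal sQ1 sh1.
exists U, (resultant Q h); split; last first.
  by rewrite resE rmorphD !rmorphM /= fct_equation mulr0 addr0 mulrC.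
(* A common divisor G of positive degree in y would make a multiple of the equation by some c in
   k[x] a product R * G, both factors of degree below N. One of them would vanish in the field K,
   against [fct_small_eq0]. *)
rewrite resultant_eq0 -leqNgt leqNgt; apply/negP => s_gcd.
have Qn0 : Q != 0 by apply: contraNneq Q0 => ->; rewrite rmorph0.
set G := gcdp Q h in s_gcd.
have G0 : G != 0 by rewrite -size_poly_gt0 (leq_trans _ s_gcd).
have sG : (size G <= N)%N by apply: leq_trans sQ; apply: dvdp_leq (dvdp_gcdl _ _).
have /Pdiv.Idomain.dvdpP[[c R] /= c0 hRG] : (G %| h)%R by apply: dvdp_gcdr.
have /eqP := congr1 fct hRG.
rewrite -mul_polyC !rmorphM /= fct_equation mulr0 eq_sym mulf_eq0.
case/orP=> /eqP /fct_small_eq0 e; last by rewrite e ?eqxx in G0.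
have h0 : c *: h != 0 by rewrite scale_poly_eq0 negb_or c0 monic_neq0 // monic_equation.
have R0 : R != 0 by apply: contraNneq h0 => R0; rewrite hRG R0 mul0r.
have := congr1 (fun p : {poly {poly k}} => size p) hRG.
rewrite size_scale // size_equation size_mul // => s_eq.
rewrite e ?eqxx // in R0.
by move: s_eq s_gcd; move: (size R) (size G) => r g; clear; lia.
Qed.

Lemma fct_fraction z : exists a b, fct b != 0 /\ z = fct a / fct b.
Proof.
have [a [b [b0 ->]]] := K_frac.2 z; exists (val a), (val b).
have valK (q : coordinate_ring f N) : in_qpoly h (val q) = q.
  by apply/val_inj; rewrite /= Pdiv.Ring.rmodp_small // size_mk_monic.
rewrite /fct /= !valK; split=> //.
by apply: contra_neq b0; rewrite -(rmorph0 j) => /K_frac.1.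
Qed.

(** The norm moves the denominator into k[x]; so 1, y, ..., y^(N-1) span K over k(x). *)
Lemma fct_fraction_poly z :
  exists (a : {poly {poly k}}) (g : {poly k}), [/\ (size a <= N)%N, g != 0 & z = fct a / fct g%:P].
Proof.
have [a [b [b0 ->]]] := fct_fraction z; have [b' [g [g0 bb']]] := fct_norm b0.
have [c sc cE] := fct_reduce (a * b'); exists c, g; split=> //.
rewrite cE -bb' rmorphM /= -mulf_div divff ?mulr1 //.
by have := g0; rewrite -fctC_eq0 -bb' mulf_eq0 negb_or => /andP[].
Qed.

Definition ev (c d : k) (Q : {poly {poly k}}) : k := Q.[d%:P].[c].

HB.instance Definition _ c d :=
  GRing.RMorphism.copy (ev c d) (horner_eval c \o horner_eval d%:P).

Lemma evX c d : ev c d 'X = d.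
Proof. by rewrite /ev hornerX hornerC. Qed.

Lemma evC c d p : ev c d p%:P = p.[c].
Proof. by rewrite /ev hornerC. Qed.

Lemma has_value_fct (P : curve iota) c d Q :
  has_value P x c -> has_value P y d -> has_value P (fct Q) (ev c d Q).
Proof.
move=> xc yd; elim/poly_ind: Q => [|Q p IHQ].
  by rewrite !rmorph0 -(rmorph0 iota); apply: has_value_cst.
rewrite !rmorphD !rmorphM /= evX evC.
by apply: has_valueD; [exact: has_valueM | rewrite fctC; exact: has_value_horner].
Qed.

(** * Local parameters at an affine point *)

Section AffinePoint.
Variables c d : k.
Hypothesis cd_curve : d ^+ N = f.[c].
Hypothesis f_sep : root f c -> ~~ root f^`() c.
Hypothesis N_unit : N%:R != 0 :> k.

Lemma ev_fct Q R : fct Q = fct R -> ev c d Q = ev c d R.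
Proof.
move/fct_eq=> [S ->]; rewrite rmorphD rmorphM rmorphB rmorphXn /=.
by rewrite evX evC cd_curve subrr mulr0 addr0.
Qed.

Lemma ev_neq0 Q : ev c d Q != 0 -> fct Q != 0.
Proof.
apply: contra_neq => Q0; rewrite -(rmorph0 (ev c d)); apply: ev_fct.
by rewrite Q0 rmorph0.
Qed.

(** Division of Q by y - d leaves a polynomial in x vanishing at c, hence divisible by x - c. *)
Lemma ev_eq0_decomp Q : ev c d Q = 0 -> exists A B : {poly {poly k}},
  fct Q = (y - iota d) * fct A + (x - iota c) * fct B.
Proof.
move=> evQ.
have : root (Q - Q.[d%:P]%:P) d%:P by rewrite rootE !hornerE subrr.
case/factor_theorem=> A QA.
have : root Q.[d%:P] c by rewrite rootE; apply/eqP.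
case/factor_theorem=> B QB; exists A, B%:P.
rewrite -[Q](subrK Q.[d%:P]%:P) rmorphD QA QB polyCM polyCB !rmorphM !rmorphB /=.
by rewrite !fctCC fctX fctCX mulrC [_ * fct B%:P]mulrC.
Qed.

(* T is x - c if d != 0, and y if d = 0. *)
Lemma uniformizer_exists : exists (T U B1 B2 U' B' : {poly {poly k}}) (e : nat),
  [/\ [/\ fct T != 0, (0 < e)%N & ev c d T = 0],
      [/\ ev c d U != 0, ev c d U' != 0 & ev c d B' != 0],
      (y - iota d) * fct U = fct T * fct B1,
      (x - iota c) * fct U = fct T * fct B2 &
      (x - iota c) * fct U' = fct T ^+ e * fct B'].
Proof.
have root_fc : root (f - f.[c]%:P) c by rewrite rootE !hornerE subrr.
have [g fg] := factor_theorem _ _ root_fc.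
have fE : fct f%:P - iota f.[c] = (x - iota c) * fct g%:P.
  have := congr1 (fun p => fct p%:P) fg.
  by rewrite polyCM !polyCB rmorphM !rmorphB /= !fctCC fctCX mulrC.
have [d0|d0] := eqVneq d 0; last first.
  (* Here y^N - d^N = f(x) - f(c) = (x - c) g(x), and the sum is the cofactor of y - d on the left,
     whose value at the point is N d^(N-1), nonzero. *)
  exists ('X - c%:P)%:P, (\sum_(i < N) 'X^(N.-1 - i) * d%:P%:P ^+ i), g%:P,
    (\sum_(i < N) 'X^(N.-1 - i) * d%:P%:P ^+ i), 1, 1, 1%N.
  have TE : fct ('X - c%:P)%:P = x - iota c.
    by rewrite polyCB rmorphB /= fctCX fctCC.
  rewrite !TE !rmorph1 oner_eq0 !expr1; split=> //.
  - rewrite -TE fctC_eq0 polyXsubC_eq0 evC !hornerE subrr; split=> //.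
  - split=> //; rewrite rmorph_sum /=.
    rewrite (eq_bigr (fun=> d ^+ N.-1)) => [|i _]; last first.
      rewrite rmorphM !rmorphXn /= evX evC hornerC -exprD; congr (_ ^+ _).
      by have := ltn_ord i; lia.
    by rewrite sumr_const card_ord -mulr_natr mulf_neq0 // expf_neq0.
  rewrite -fE -cd_curve -curve_equation rmorphXn /=.
  have := congr1 (fct) (subrXX 'X d%:P%:P N).
  by rewrite rmorphM !rmorphB !rmorphXn /= fctX fctCC => ->.
move: cd_curve; rewrite d0 expr0n eqn0Ngt N_gt0 /= => /esym fc0.
have gc0 : g.[c] != 0.
  have := f_sep; rewrite !rootE fc0 eqxx => /(_ isT).
  move: fg; rewrite fc0 subr0 => ->.
  by rewrite derivM derivB derivX derivC !hornerE subrr mulr0 add0r subr0 mulr1.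
have y0 : y != 0.
  have : y ^+ N != 0.
    rewrite curve_equation fctC_eq0; apply: contraNneq gc0 => f0.
    move/eqP: fg; rewrite f0 horner0 subrr eq_sym mulf_eq0 polyXsubC_eq0 orbF.
    by move/eqP->; rewrite horner0.
  by rewrite expf_eq0 N_gt0.
rewrite fc0 rmorph0 subr0 in fE.
(* Here y^N = (x - c) g(x) with g(c) = f'(c) nonzero: up to a unit, x - c is y^N, whence the
   exponent N. *)
exists 'X, g%:P, g%:P, 'X^(N.-1), g%:P, 1, N.
rewrite !rmorph1 oner_eq0 !evX !evC rmorph0 subr0 fctX.
split=> //; first by rewrite rmorphXn /= fctX -exprS prednK // curve_equation fE.
by rewrite mulr1 curve_equation fE.
Qed.

End AffinePoint.
End CoordinateRing.

Lemma valuation_exprz (k : closedFieldType) (K : fieldType) (iota : {rmorphism k -> K})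
    (v : K -> int) a (n : int) :
  discrete_valuation iota v -> a != 0 -> v (a ^ n) = v a * n.
Proof.
move=> dv a0; case: n => n; first by rewrite -exprnP (valuationX dv) // -mulr_natr natz.
by rewrite NegzE -invr_expz (valuationV dv) ?expf_neq0 // (valuationX dv) // mulrN -mulr_natr natz.
Qed.

Lemma finite_subsingleton T (A : set T) :
  (forall P Q, A P -> A Q -> P = Q) -> finite_set A.
Proof.
move=> eqA; have [->|/set0P[P AP]] := eqVneq A set0; first exact: finite_set0.
by apply: sub_finite_set (finite_set1 P) => Q AQ /=; apply: eqA.
Qed.

Lemma finite_roots (k : closedFieldType) (g : {poly k}) :
  g != 0 -> finite_set [set c | root g c].
Proof.
move=> g0; have [r gr] := closed_field_poly_normal g.
apply: sub_finite_set (finite_seq r) => c /=.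
by rewrite gr rootZ ?lead_coef_eq0 // root_prod_XsubC.
Qed.

(** Euclid's argument: a root of 1 plus the product of all the 'X - a would differ from every a. *)
Lemma infinite_closed_field (k : closedFieldType) : infinite_set [set: k].
Proof.
move=> /finite_seqP[r rE].
have rA a : a \in r by have : [set: k] a by []; rewrite rE.
have [|c] := @closed_rootP k (1 + \prod_(a <- r) ('X - a%:P)) _.
  rewrite addrC; apply/eqP => s1.
  have /eqP := s1; have [|s_gt1] := leqP (size (\prod_(a <- r) ('X - a%:P))) 1.
    rewrite size_prod_XsubC ltnS leqn0 size_eq0 => /eqP r0.
    by have := rA 0; rewrite r0.
  by rewrite size_polyDl ?size_poly1 // => /eqP s_eq1; rewrite s_eq1 in s_gt1.
rewrite rootE !hornerE horner_prod.
by rewrite (big_rem c) //= !hornerE subrr mul0r addr0 oner_eq0.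
Qed.

(** * Orders of vanishing at an affine point *)

Section AffineFactorization.
Variables (k : closedFieldType) (f : {poly k}) (N : nat) (K : fieldType).
Variable j : {rmorphism coordinate_ring f N -> K}.
Hypotheses (N_gt0 : (0 < N)%N) (K_frac : is_fraction_field j).

Local Notation x := (coord_x j).
Local Notation y := (coord_y j).
Local Notation iota := (base_emb j).
Local Notation fct := (fct j).
Implicit Types (Q R T U V A B : {poly {poly k}}) (g p : {poly k}).

Section AffinePoint.
Variables c d : k.
Hypothesis cd_curve : d ^+ N = f.[c].
Hypothesis f_sep : root f c -> ~~ root f^`() c.
Hypothesis N_unit : N%:R != 0 :> k.

Let ev_neq0 := ev_neq0 N_gt0 K_frac cd_curve.

(* Descent on the norm g of Q, kept in the form g T^m V with V invertible at the
   point: a factor x - c of g is worth e factors T. *)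
Lemma affine_factorization : exists T, [/\ fct T != 0, ev c d T = 0 &
  forall Q, fct Q != 0 -> exists n U B,
    [/\ ev c d U != 0, ev c d B != 0 & fct Q * fct U = fct T ^+ n * fct B]].
Proof.
have [T [U [B1 [B2 [U' [B' [e [[T0 e_gt0 evT] [U0 U'0 B'0] yU xU xU']]]]]]]] :=
  uniformizer_exists N_gt0 K_frac cd_curve f_sep N_unit.
exists T; split=> // Q Q0.
have [R [g [g0 QR]]] := fct_norm N_gt0 K_frac Q0.
(* A root of g weighs e in the measure: replacing a factor x - c of g by T^e, of which one T is
   cancelled at once, leaves m = e - 1 and still decreases it. *)
suff main s : forall Q R g m V, (e * size g + m < s)%N -> g != 0 ->
    ev c d V != 0 -> fct Q * fct R = fct g%:P * fct T ^+ m * fct V ->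
    exists n U B, [/\ ev c d U != 0, ev c d B != 0 &
      fct Q * fct U = fct T ^+ n * fct B].
  apply: (main _ Q R g 0%N 1 (ltnSn _)) => //; first by rewrite rmorph1 oner_eq0.
  by rewrite rmorph1 !mulr1.
elim: s => // s IHs {Q0 R g g0 QR}Q R g m V ms g0 V0 QR.
have [evQ|evQ] := eqVneq (ev c d Q) 0; last first.
  by exists 0%N, 1, Q; rewrite !rmorph1 oner_eq0 mulr1 mul1r.
have [A [B QAB]] := ev_eq0_decomp j N_gt0 evQ.
(* Both y - d and x - c become multiples of T after multiplication by the unit U, hence so does
   Q. *)
pose Q1 := B1 * A + B2 * B.
have QU : fct Q * fct U = fct T * fct Q1.
  rewrite QAB rmorphD !rmorphM /= mulrDr !mulrA -yU -xU; ring.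
suff [n [U1 [B3 [U10 B30 Q1E]]]] : exists n U B,
    [/\ ev c d U != 0, ev c d B != 0 & fct Q1 * fct U = fct T ^+ n * fct B].
  exists n.+1, (U * U1), B3; rewrite rmorphM mulf_neq0 //; split=> //.
  by rewrite rmorphM /= mulrA QU -mulrA Q1E mulrA -exprS.
have VU0 : ev c d (V * U) != 0 by rewrite rmorphM mulf_neq0.
case: m => [|m] in ms QR.
  have QR' : fct T * fct Q1 * fct R = fct g%:P * fct (V * U).
    by rewrite -QU rmorphM /= mulrAC QR expr0; ring.
  have : root g c.
    have evE : fct (T * Q1 * R) = fct (g%:P * (V * U)).
      by rewrite [LHS]rmorphM [RHS]rmorphM /= -QR' [fct (T * _)]rmorphM.
    have /eqP := ev_fct N_gt0 K_frac cd_curve evE.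
    by rewrite !rmorphM /= evT !mul0r eq_sym !mulf_eq0 (negPf U0) (negPf V0) !orbF evC.
  case/factor_theorem=> g1 gE.
  have g10 : g1 != 0 by apply: contraNneq g0 => g10; rewrite gE g10 mul0r.
  apply: (IHs Q1 (R * U') g1 e.-1 (B' * (V * U))) => //.
  - move: ms; rewrite gE size_Mmonic ?monicXsubC // size_XsubC addn2 /= mulnS.
    by move: (e * _)%N => t; move: e_gt0; clear; lia.
  - by rewrite rmorphM mulf_neq0.
  apply: (mulfI T0).
  transitivity (fct T * fct Q1 * fct R * fct U').
    by rewrite [fct (R * U')]rmorphM /=; ring.
  have gE' : fct g%:P = fct g1%:P * (x - iota c).
    rewrite gE polyCM polyCB rmorphM rmorphB /=.
    by rewrite (fctCX j N_gt0) (fctCC j N_gt0).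
  transitivity (fct g1%:P * fct (V * U) * ((x - iota c) * fct U')).
    by rewrite QR' gE'; ring.
  rewrite xU' -{1}(prednK e_gt0) exprS [fct (B' * _)]rmorphM /=; ring.
apply: (IHs Q1 R g m (V * U)) => //; first by move: ms; rewrite addnS ltnS.
apply: (mulfI T0); rewrite mulrA -QU mulrAC QR exprS rmorphM /=; ring.
Qed.

(** The quotient [fct B / fct U] stands for a unit of the local ring at (c, d). *)
Definition has_order T (z : K) (n : int) := exists U B,
  [/\ ev c d U != 0, ev c d B != 0 & z = fct T ^ n * fct B / fct U].

Lemma affine_order : exists T, [/\ fct T != 0, ev c d T = 0 &
  forall z, z != 0 -> exists n, has_order T z n].
Proof.
have [T [T0 evT TE]] := affine_factorization; exists T; split=> // z.
have [a [b [b0 ->]]] := fct_fraction K_frac z.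
rewrite mulf_eq0 invr_eq0 (negPf b0) orbF => a0.
have [m [Ua [Ba [Ua0 Ba0 aE]]]] := TE _ a0.
have [n [Ub [Bb [Ub0 Bb0 bE]]]] := TE _ b0.
exists (m%:Z - n%:Z), (Ua * Bb), (Ba * Ub).
rewrite !rmorphM !mulf_neq0 //; split=> //=.
rewrite expfzDr // -invr_expz -!exprnP.
have [Ua1 Ub1 Bb1] := And3 (ev_neq0 Ua0) (ev_neq0 Ub0) (ev_neq0 Bb0).
rewrite (canRL (mulfK Ua1) aE) (canRL (mulfK Ub1) bE).
have Tn0 : fct T ^+ n != 0 by rewrite expf_neq0.
by field; rewrite Ua1 Tn0 Bb1 Ub1.
Qed.

End AffinePoint.
End AffineFactorization.

(** * The unique point of the curve above a solution (c, d) of the equation *)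

Section AffineValuations.
Variables (k : closedFieldType) (f : {poly k}) (N : nat) (K : fieldType).
Variable j : {rmorphism coordinate_ring f N -> K}.
Hypotheses (N_gt0 : (0 < N)%N) (K_frac : is_fraction_field j).

Local Notation x := (coord_x j).
Local Notation y := (coord_y j).
Local Notation iota := (base_emb j).
Local Notation fct := (fct j).
Implicit Types (Q R T U V A B : {poly {poly k}}) (g p : {poly k}).

Section AffinePoint.
Variables c d : k.
Hypothesis cd_curve : d ^+ N = f.[c].
Hypothesis f_sep : root f c -> ~~ root f^`() c.
Hypothesis N_unit : N%:R != 0 :> k.

Let ev_neq0 := ev_neq0 N_gt0 K_frac cd_curve.
Let ev_fct := ev_fct N_gt0 K_frac cd_curve.
Local Notation has_order := (has_order j c d).

(** If n exceeded m, cancelling T^m and evaluating at (c, d), where T vanishes, would make B U'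
    vanish there. Used in both directions, this makes the order unique. *)
Lemma has_order_le T z (m n : int) : fct T != 0 -> ev c d T = 0 ->
  has_order T z m -> has_order T z n -> n <= m.
Proof.
move=> T0 evT [U [B [U0 B0 ->]]] [U' [B' [U'0 B'0]]] eqz.
rewrite leNgt; apply/negP => mn.
have [l lE] : exists l : nat, n = m + l.+1%:Z by exists (absz (n - m)).-1; clear -mn; lia.
have [U1 U'1] := conj (ev_neq0 U0) (ev_neq0 U'0).
have Tm0 : fct T ^ m != 0 by rewrite expfz_neq0.
have /ev_fct : fct (B * U') = fct (T * (T ^+ l * B' * U)).
  rewrite !rmorphM rmorphXn /=; apply: (mulfI Tm0).
  rewrite mulrA; transitivity (fct T ^ m * fct B / fct U * (fct U * fct U')).
    by move: (fct T ^ m) => t; field; rewrite U1.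
  rewrite eqz lE expfzDr // -exprnP exprS.
  by move: (fct T ^ m) => t; field; rewrite U'1.
rewrite !rmorphM /= evT mul0r => /eqP.
by rewrite mulf_eq0 (negPf B0) (negPf U'0).
Qed.

(** For n = -l with l >= 0, evaluate Q U T^l = B at (c, d): B does not vanish there, so l = 0 and
    neither does Q. *)
Lemma has_order_fct T Q n : fct T != 0 -> ev c d T = 0 ->
  has_order T (fct Q) n -> 0 <= n /\ (ev c d Q = 0 -> 0 < n).
Proof.
move=> T0 evT [U [B [U0 B0 QE]]].
have U1 := ev_neq0 U0.
have QU l : n = - l%:Z -> ev c d Q * ev c d U * ev c d T ^+ l = ev c d B.
  move=> nE; rewrite -rmorphXn -!rmorphM; apply: ev_fct.
  rewrite !rmorphM rmorphXn /= QE divfK // nE -invr_expz -exprnP mulrC mulrA.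
  by rewrite mulfV ?mul1r // expf_neq0.
split.
  rewrite leNgt; apply/negP => n_lt0.
  have := QU `|n|.-1.+1%N; rewrite exprS evT mul0r mulr0 => e.
  by move/eqP: B0; apply; rewrite -e //; lia.
move=> evQ; rewrite ltNge; apply/negP => n_le0.
have := QU `|n|%N; rewrite evQ !mul0r => e.
by move/eqP: B0; apply; rewrite -e //; lia.
Qed.

Lemma affine_valuation_exists : exists v : K -> int, discrete_valuation iota v /\
  forall Q, ev c d Q = 0 -> val_ge v 1 (fct Q).
Proof.
have [T [T0 evT ordT]] := affine_order N_gt0 K_frac cd_curve f_sep N_unit.
have /choice [v vP] z : exists n : int, z != 0 -> has_order T z n.
  have [->|z0] := eqVneq z 0; first by exists 0.
  by have [n] := ordT z z0; exists n.
have vE z n : z != 0 -> has_order T z n -> v z = n.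
  move=> z0 zn; have zv := vP z z0; apply: le_anti.
  by rewrite (has_order_le T0 evT zn zv) (has_order_le T0 evT zv zn).
exists v; split; first split.
- move=> a b a0 b0; have [U [B [U0 B0 aE]]] := vP a a0.
  have [U' [B' [U'0 B'0 bE]]] := vP b b0.
  have [U1 U'1] := conj (ev_neq0 U0) (ev_neq0 U'0).
  apply: vE; first by rewrite mulf_neq0.
  exists (U * U'), (B * B'); rewrite !rmorphM !mulf_neq0 //; split=> //=.
  rewrite [in LHS]aE [in LHS]bE expfzDr //.
  by move: (_ ^ v a) (_ ^ v b) => s t; field; rewrite U1 U'1.
- suff main a b : a != 0 -> b != 0 -> a + b != 0 -> v a <= v b -> v a <= v (a + b).
    move=> a b a0 b0 ab0; case: (leP (v a) (v b)) => [|/ltW] vab; first exact: main.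
    by rewrite addrC main // addrC.
  move=> a0 b0 ab0 vab; have [U [B [U0 B0 aE]]] := vP a a0.
  have [U' [B' [U'0 B'0 bE]]] := vP b b0.
  have [U1 U'1] := conj (ev_neq0 U0) (ev_neq0 U'0).
  have [l lE] : exists l : nat, v b = v a + l%:Z
    by exists (absz (v b - v a)); rewrite gez0_abs ?subr_ge0 // [RHS]addrC subrK.
  have Ta0 : fct T ^ v a != 0 by rewrite expfz_neq0.
  (* With T^(v a) factored out, what remains of a + b is a polynomial Q over units, and polynomials
     have order at least 0. *)
  pose Q := B * U' + T ^+ l * B' * U.
  have abE : a + b = fct T ^ v a * fct Q / (fct U * fct U').
    rewrite [in LHS]aE [in LHS]bE lE expfzDr // rmorphD !rmorphM rmorphXn /=.
    by rewrite -exprnP; move: (fct T ^ v a) => t; field; rewrite U1 U'1.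
  have Q0 : fct Q != 0 by apply: contraNneq ab0 => Q0; rewrite abE Q0 mulr0 mul0r.
  have [U2 [B2 [U20 B20 QE]]] := vP _ Q0.
  have [vQ _] := has_order_fct T0 evT (vP _ Q0).
  rewrite (@vE (a + b) (v a + v (fct Q))) ?lerDl //.
  exists (U2 * (U * U')), B2; rewrite !rmorphM !mulf_neq0 //; split=> //=.
  rewrite [LHS]abE {1}QE expfzDr //; have U21 := ev_neq0 U20.
  move: (fct T ^ v a) (fct T ^ v (fct Q)) => s t.
  by field; rewrite U1 U'1 U21.
- move=> e e0; apply: vE; first by rewrite fmorph_eq0.
  exists 1, e%:P%:P; rewrite !rmorph1 oner_eq0 evC hornerC; split=> //.
  by rewrite fctCC // expr0z mul1r divr1.
- exists (fct T) => //; apply: vE => //.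
  by exists 1, 1; rewrite !rmorph1 oner_eq0 expr1z mulr1 divr1.
move=> Q evQ; have [->|Q0] := eqVneq (fct Q) 0; first by left.
by right; rewrite -gtz0_ge1; have [_ ->] := has_order_fct T0 evT (vP _ Q0).
Qed.

Lemma affine_point_exists :
  exists P : curve iota, has_value P x c /\ has_value P y d.
Proof.
have [v [dv vP]] := affine_valuation_exists.
have R_dvr : is_dvr iota (valuation_ring v) by exists v.
have PE z e := has_valueE z e dv (erefl : local_ring (Point R_dvr) = _).
exists (Point R_dvr); split; apply/PE.
  have -> : x - iota c = fct ('X - c%:P)%:P.
    by rewrite fct_XsubCC.
  by apply: vP; rewrite evC !hornerE subrr.
have -> : y - iota d = fct ('X - d%:P%:P) by rewrite fct_XsubC.
by apply: vP; rewrite /ev hornerXsubC subrr horner0.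
Qed.

(** Polynomials nonzero at (c, d) are units at such a point, so its valuation is v(T) times the
    order. As v(T) > 0 and the value 1 is attained, v(T) = 1, and both points carry the same
    valuation. *)
Lemma affine_point_unique (P P' : curve iota) :
  has_value P x c -> has_value P y d -> has_value P' x c -> has_value P' y d ->
  P = P'.
Proof.
have [T [T0 evT ordT]] := affine_order N_gt0 K_frac cd_curve f_sep N_unit.
have vE (R : curve iota) v : has_value R x c -> has_value R y d ->
    discrete_valuation iota v -> local_ring R = valuation_ring v ->
    forall z n, z != 0 -> has_order T z n -> v z = n.
  move=> xc yd dv Rv.
  have v0 Q : ev c d Q != 0 -> v (fct Q) = 0.
    move=> Q0; have Q1 := ev_neq0 Q0; have Qev := has_value_fct N_gt0 Q xc yd.
    have := has_value_local Qev; rewrite Rv => -[/eqP|]; first by rewrite (negPf Q1).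
    have := has_value_local (has_valueV Q0 Qev).
    rewrite Rv => -[/eqP|]; first by rewrite invr_eq0 (negPf Q1).
    by rewrite (valuationV dv) // oppr_ge0 => ? ?; apply: le_anti; apply/andP.
  have vT z n : z != 0 -> has_order T z n -> v z = v (fct T) * n.
    move=> z0 [U [B [U0 B0 ->]]]; have [U1 B1] := conj (ev_neq0 U0) (ev_neq0 B0).
    rewrite !(valuationM dv) ?mulf_neq0 ?invr_eq0 ?expfz_neq0 //.
    by rewrite (valuationV dv) // (v0 _ U0) (v0 _ B0) oppr0 !addr0 (valuation_exprz n dv).
  have vT1 : v (fct T) = 1.
    case: (dv) => _ _ _ [t t0 vt]; have [n tn] := ordT t t0.
    have := vT t n t0 tn; rewrite vt => /esym e.
    have : 0 < v (fct T).
      have := has_value_fct N_gt0 T xc yd; rewrite evT.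
      move=> /(has_valueE _ _ dv Rv); rewrite rmorph0 subr0.
      by case=> [/eqP|]; [rewrite (negPf T0) | rewrite gtz0_ge1].
    move=> vT_gt0; have n_gt0 : 0 < n by rewrite -(pmulr_rgt0 _ vT_gt0) e.
    nia.
  by move=> z n z0 zn; rewrite (vT _ _ z0 zn) vT1 mul1r.
move=> xc yd xc' yd'.
have [v dv Pv] := pointP P; have [v' dv' Pv'] := pointP P'.
apply: point_ext; rewrite Pv Pv'.
have vv' z : z != 0 -> v z = v' z.
  move=> z0; have [n zn] := ordT z z0.
  by rewrite (vE P v xc yd dv Pv z n) // (vE P' v' xc' yd' dv' Pv' z n).
apply/seteqP; split=> z [->|]; try (by left);
  by have [->|/vv' e] := eqVneq z 0; [left | right; rewrite ?e // -e].
Qed.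

End AffinePoint.
End AffineValuations.

(** * The point at infinity, and the values of x and y at the other points *)

Section Centers.
Variables (k : closedFieldType) (f : {poly k}) (N : nat) (K : fieldType).
Variable j : {rmorphism coordinate_ring f N -> K}.
Hypotheses (N_gt0 : (0 < N)%N) (K_frac : is_fraction_field j).
Hypothesis f_neq0 : f != 0.
Hypothesis Nm_coprime : coprime N (size f).-1.
Hypothesis f_sep : forall c, root f c -> ~~ root f^`() c.
Hypothesis N_unit : N%:R != 0 :> k.

Local Notation x := (coord_x j).
Local Notation y := (coord_y j).
Local Notation iota := (base_emb j).
Local Notation fct := (fct j).
Local Notation m := (size f).-1.
Implicit Types (Q R T U V A B : {poly {poly k}}) (g p : {poly k}).

Lemma coord_x_neq0 : x != 0.
Proof. by rewrite -(fctCX j N_gt0) fctC_eq0 // polyX_eq0. Qed.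

Lemma coord_y_neq0 : y != 0.
Proof.
have : y ^+ N != 0 by rewrite curve_equation // fctC_eq0.
by rewrite expf_eq0 N_gt0.
Qed.

Lemma fct_sum Q : (size Q <= N)%N ->
  fct Q = \sum_(i < N) fct (Q`_i)%:P * y ^+ i.
Proof.
move=> sQ; rewrite -[in LHS](coefK Q) poly_def rmorph_sum /=.
rewrite (big_ord_widen N (fun i => fct (Q`_i *: 'X^i)) sQ) big_mkcond /=.
apply: eq_bigr => i _; case: ifP => [_|/negbT]; last first.
  by rewrite -leqNgt => /leq_sizeP/(_ _ (leqnn _)) ->; rewrite !rmorph0 mul0r.
by rewrite -mul_polyC rmorphM rmorphXn.
Qed.

Lemma valuation_curve_equation v : discrete_valuation iota v ->
  v y *+ N = v (fct f%:P).
Proof. by move=> dv; rewrite -(valuationX dv) ?coord_y_neq0 // curve_equation. Qed.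

Section AtInfinity.
Variable v : K -> int.
Hypothesis dv : discrete_valuation iota v.
Hypothesis vx : v x < 0.

Lemma valuation_fctC p : p != 0 -> v (fct p%:P) = v x * (size p).-1%:Z.
Proof.
elim/poly_ind: p => [|p c IHp]; first by rewrite eqxx.
have pE : fct (p * 'X + c%:P)%:P = fct p%:P * x + iota c.
  by rewrite polyCD polyCM rmorphD rmorphM /= (fctCX j N_gt0) (fctCC j N_gt0).
move=> p1; rewrite pE size_MXaddC; have [p0|p0] := eqVneq p 0.
  rewrite p0 mul0r add0r polyC_eq0 in p1.
  by rewrite p0 rmorph0 mul0r add0r (valuation_cst dv) // (negPf p1) size_poly0 mulr0.
have vpx : v (fct p%:P * x) = v x * (size p)%:Z.
  rewrite (valuationM dv) ?fctC_eq0 ?coord_x_neq0 // IHp //.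
  by rewrite -{2}[v x]mulr1 -mulrDr -{2}(@prednK (size p)) ?size_poly_gt0 // -addn1 PoszD.
rewrite /= -vpx; apply: (valuation_addl dv _ _).2.
  by rewrite mulf_neq0 ?coord_x_neq0 // fctC_eq0.
apply: (val_geW _ (val_ge_cst dv c)).
by rewrite vpx lezD1 pmulr_llt0 // ltz_nat size_poly_gt0.
Qed.

(** From N v(y) = m v(x) and N coprime to m, N divides v(x). That e = 1 is only seen in
    [valuation_infinity], once all orders are known to be multiples of e. *)
Lemma order_at_infinity : exists2 e : nat, (0 < e)%N &
  v x = - (N * e)%:Z /\ v y = - (m * e)%:Z.
Proof.
have e1 : v y * N%:Z = v x * m%:Z.
  by rewrite -valuation_fctC // -(valuation_curve_equation dv) -mulr_natr natz.
have e2 : (`|v y| * N = `|v x| * m)%N by rewrite -[m]absz_nat -abszM -e1 abszM.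
have : (N %| `|v x| * m)%N by rewrite -e2 dvdn_mull.
rewrite Gauss_dvdl // => /dvdnP[e eE].
have e_gt0 : (0 < e)%N by rewrite lt0n; apply/eqP => e0; move: eE vx; rewrite e0; clear; lia.
exists e => //; have xE : v x = - (N * e)%:Z by move: eE vx; clear; lia.
split=> //; apply: (@mulIf _ N%:Z); first by rewrite -lt0n.
by rewrite e1 xE !mulNr -!PoszM [(m * e)%N]mulnC -mulnA mulnC.
Qed.

(** The pole order of Q_i(x) y^i when x and y have poles of orders N and m. The truncated degree of
    a zero coefficient is 0, hence the condition in [pole_order]. *)
Definition weight Q (i : nat) := (N * (size (Q`_i)%R).-1 + m * i)%N.

(* The terms Q_i(x) y^i have pairwise distinct orders at infinity, as N and the
   degree of f are coprime. *)
Lemma weight_inj Q (i l : 'I_N) : weight Q i = weight Q l -> i = l.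
Proof.
clear N_unit; wlog il : i l / (i <= l)%N => [H e|].
  by case/orP: (leq_total i l) => le; [apply: H | apply/esym/H].
rewrite /weight => e; apply/val_inj/eqP; rewrite eqn_leq il /= -subn_eq0.
have : (N %| m * (l - i))%N.
  apply/dvdnP; exists ((size (Q`_i)%R).-1 - (size (Q`_l)%R).-1)%N.
  by rewrite mulnBr mulnBl mulnC [(_.-1 * N)%N]mulnC; lia.
rewrite Gauss_dvdr // => /dvdnP[q qE]; rewrite qE.
by have := ltn_ord l; case: q qE => // q; rewrite mulSn; lia.
Qed.

Definition pole_order Q := \max_(i < N | Q`_i != 0) weight Q i.

(** Distinct weights leave a single term with the largest pole order, and it dominates the sum. *)
Lemma valuation_fct Q e : (size Q <= N)%N -> Q != 0 ->
  v x = - (N * e)%:Z -> v y = - (m * e)%:Z ->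
  v (fct Q) = - (e * pole_order Q)%:Z.
Proof.
move=> sQ Q0 xE yE.
have e_gt0 : (0 < e)%N by rewrite lt0n; apply/eqP=> e0; move: vx; rewrite xE e0 muln0.
have termE i : Q`_i != 0 -> v (fct (Q`_i)%:P * y ^+ i) = - (e * weight Q i)%:Z.
  move=> Qi0; rewrite (valuationM dv) ?fctC_eq0 ?expf_neq0 ?coord_y_neq0 //.
  rewrite valuation_fctC // (valuationX dv) ?coord_y_neq0 // xE yE -mulr_natr natz.
  by rewrite !mulNr -opprD -!PoszM -PoszD; congr (- Posz _); rewrite /weight; ring.
have [i0 Qi0 maxE] : exists2 i0 : 'I_N, Q`_i0 != 0 & pole_order Q = weight Q i0.
  have lc0 : Q`_(size Q).-1 != 0 by rewrite -/(lead_coef Q) lead_coef_eq0.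
  have sN : ((size Q).-1 < N)%N by move: Q0 sQ; rewrite -size_poly_gt0; case: (size Q).
  pose S := [pred i : 'I_N | Q`_i != 0].
  have S_gt0 : (0 < #|S|)%N by apply/card_gt0P; exists (Ordinal sN).
  by have [i0 Si0 maxE] := eq_bigmax_cond (fun i : 'I_N => weight Q i) S_gt0; exists i0.
rewrite fct_sum // (bigD1 i0) //= maxE -termE //.
apply: (valuation_addl dv _ _).2.
  by rewrite mulf_neq0 ?expf_neq0 ?coord_y_neq0 ?fctC_eq0.
apply: (val_ge_sum dv) => // i ii0; have [Qi|Qi] := eqVneq Q`_i 0.
  by left; rewrite Qi !rmorph0 mul0r.
right; rewrite !termE //.
have : (weight Q i < weight Q i0)%N.
  rewrite ltn_neqAle; apply/andP; split.
    by apply: contraNneq ii0 => /weight_inj ->.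
  by rewrite -maxE; apply: leq_bigmax_cond.
by move=> lt_w; rewrite lezD1 ltrN2 ltz_nat ltn_pmul2l.
Qed.

(** The right-hand side does not involve [v], so there is at most one place with v x < 0. *)
Lemma valuation_infinity z a b : fct a != 0 -> fct b != 0 ->
  (size a <= N)%N -> (size b <= N)%N -> z = fct a / fct b ->
  v z = (pole_order b)%:Z - (pole_order a)%:Z.
Proof.
have [e e_gt0 [xE yE]] := order_at_infinity.
have neq0 Q : fct Q != 0 -> Q != 0 by apply: contraNneq => ->; rewrite rmorph0.
have vE c d : fct c != 0 -> fct d != 0 -> (size c <= N)%N -> (size d <= N)%N ->
    v (fct c / fct d) = e%:Z * ((pole_order d)%:Z - (pole_order c)%:Z).
  move=> c0 d0 sc sd; rewrite (valuationM dv) ?invr_eq0 // (valuationV dv) //.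
  rewrite !(valuation_fct _ _ xE yE) ?neq0 // mulrBr -!PoszM opprK addrC //.
(* All orders are multiples of e, and some element has order 1. *)
move=> a0 b0 sa sb ->; rewrite vE //; suff -> : e = 1%N by rewrite mul1r.
case: (dv) => _ _ _ [t t0 vt].
have [c [d [d0 tE]]] := fct_fraction K_frac t.
have [c' sc c'E] := fct_reduce j N_gt0 c; have [d' sd d'E] := fct_reduce j N_gt0 d.
move: vt t0; rewrite tE -c'E -d'E => + t0.
have c'0 : fct c' != 0 by apply: contraNneq t0 => ->; rewrite mul0r.
rewrite vE // ?d'E // => /(congr1 absz); rewrite abszM /= => /eqP.
by rewrite muln_eq1 => /andP[/eqP].
Qed.

End AtInfinity.

Lemma infinity_unique (P P' : curve iota) v v' :
  discrete_valuation iota v -> local_ring P = valuation_ring v -> v x < 0 ->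
  discrete_valuation iota v' -> local_ring P' = valuation_ring v' -> v' x < 0 ->
  P = P'.
Proof.
move=> dv Pv vx dv' Pv' vx'; apply: point_ext; rewrite Pv Pv'.
have vv' z : z != 0 -> v z = v' z.
  move=> z0.
  have [c [d [d0 tE]]] := fct_fraction K_frac z.
  have [c' sc c'E] := fct_reduce j N_gt0 c; have [d' sd d'E] := fct_reduce j N_gt0 d.
  move: tE z0; rewrite -c'E -d'E => tE z0.
  have c'0 : fct c' != 0 by apply: contraNneq z0 => c0; rewrite tE c0 mul0r.
  have d'0 : fct d' != 0 by rewrite d'E.
  by rewrite (valuation_infinity dv vx c'0 d'0 sc sd tE)
             (valuation_infinity dv' vx' c'0 d'0 sc sd tE).
apply/seteqP; split=> z [->|]; try (by left);
  by have [->|/vv' e] := eqVneq z 0; [left | right; rewrite ?e // -e].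
Qed.

(* Otherwise the valuation would be trivial on k(x), hence on its algebraic
   extension K. *)
Lemma center_x (P : curve iota) v :
  discrete_valuation iota v -> local_ring P = valuation_ring v -> 0 <= v x ->
  exists c, has_value P x c.
Proof.
move=> dv Pv vx; apply: contrapT => NP.
have vxc c : v (x - iota c) = 0 /\ x - iota c != 0.
  have nge : ~ val_ge v 1 (x - iota c).
    by move/(has_valueE _ _ dv Pv) => Pc; apply: NP; exists c.
  have xc0 : x - iota c != 0 by apply/eqP => xc0; apply: nge; left.
  split=> //; apply: le_anti; apply/andP; split.
    by rewrite leNgt; apply/negP => gt0; apply: nge; right; rewrite -gtz0_ge1.
  have : val_ge v 0 (x - iota c).
    apply: (val_geD dv) => //; first by right.
    by apply: (val_geN dv) => //; apply: val_ge_cst.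
  by case=> [/eqP|//]; rewrite (negPf xc0).
have vp p : p != 0 -> v (fct p%:P) = 0.
  move=> p0; have [r pr] := closed_field_poly_normal p.
  rewrite pr -mul_polyC polyCM rmorphM /= (valuationM dv); last 2 first.
  - by rewrite fctC_eq0 // polyC_eq0 lead_coef_eq0.
  - by rewrite fctC_eq0 // monic_neq0 // monic_prod_XsubC.
  rewrite (fctCC j N_gt0) (valuation_cst dv) ?lead_coef_eq0 // add0r {p p0 pr}.
  elim: r => [|a r IHr]; first by rewrite big_nil rmorph1 (valuation1 dv).
  rewrite big_cons polyCM rmorphM /= (valuationM dv) ?IHr ?addr0.
  - by rewrite fct_XsubCC //; case: (vxc a).
  - by rewrite fct_XsubCC //; case: (vxc a).
  - by rewrite fctC_eq0 // monic_neq0 // monic_prod_XsubC.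
have vy : v y = 0.
  have /eqP := valuation_curve_equation dv.
  by rewrite vp // mulrn_eq0 (gtn_eqF N_gt0) => /eqP.
have vQ Q : val_ge v 0 (fct Q).
  elim/poly_ind: Q => [|Q p IHQ]; first by left; rewrite rmorph0.
  rewrite rmorphD rmorphM /=; apply: (val_geD dv) => //.
    by rewrite -[0]addr0; apply: (val_geM dv) => //; right; rewrite fctX vy.
  have [->|p0] := eqVneq p 0; first by left; rewrite rmorph0.
  by right; rewrite vp.
(* Q and its cofactor R in the norm have orders at least 0, with sum 0 since the norm lies in
   k[x]. *)
have vQ0 Q : fct Q != 0 -> v (fct Q) = 0.
  move=> Q0; have [R [g [g0 QR]]] := fct_norm N_gt0 K_frac Q0.
  have R0 : fct R != 0.
    by have := g0; rewrite -(fctC_eq0 N_gt0 K_frac) -QR mulf_eq0 negb_or => /andP[].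
  have := vp g g0; rewrite -QR (valuationM dv) //.
  have [/eqP|] := vQ Q; first by rewrite (negPf Q0).
  have [/eqP|] := vQ R; first by rewrite (negPf R0).
  by clear; lia.
case: (dv) => _ _ _ [t t0 vt].
have [a [b [b0 tE]]] := fct_fraction K_frac t.
have a0 : fct a != 0 by apply: contraNneq t0 => a0; rewrite tE a0 mul0r.
by move: vt; rewrite tE (valuationM dv) ?invr_eq0 // (valuationV dv) // !vQ0.
Qed.

(** X^N - f(c) splits over k. If y had no value at P, no y - d would have positive order, and
    neither would their product y^N - f(c), which has value 0. *)
Lemma center_y (P : curve iota) c : has_value P x c ->
  exists2 d, has_value P y d & d ^+ N = f.[c].
Proof.
move=> xc; suff [d yd] : exists d, has_value P y d.
  exists d => //; apply: has_value_uniq (has_valueX N yd) _.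
  by rewrite curve_equation // (fctC j N_gt0); apply: has_value_horner.
have [v dv Pv] := pointP P.
have yN : has_value P (map_poly iota ('X^N - f.[c]%:P)).[y] 0.
  rewrite rmorphB /= map_polyXn map_polyC !hornerE -[0](subrr f.[c]).
  apply: has_valueB; last exact: has_value_cst.
  by rewrite curve_equation // (fctC j N_gt0); apply: has_value_horner.
have [r rE] := closed_field_poly_normal ('X^N - f.[c]%:P).
have lc1 : lead_coef ('X^N - f.[c]%:P) = 1.
  by apply/eqP; rewrite -monicE monicXnsubC.
rewrite lc1 scale1r in rE.
move: yN; rewrite rE => /(has_valueE _ _ dv Pv); rewrite rmorph0 subr0.
rewrite rmorph_prod horner_prod /=.
apply: contraPP => Ny.
have vy d : y - iota d != 0 /\ v (y - iota d) <= 0.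
  have nge : ~ val_ge v 1 (y - iota d).
    by move/(has_valueE _ _ dv Pv) => Pc; apply: Ny; exists d.
  split; first by apply/eqP => yd0; apply: nge; left.
  by rewrite leNgt; apply/negP => gt0; apply: nge; right; rewrite -gtz0_ge1.
suff [p0 vp] : \prod_(i <- r) (map_poly iota ('X - i%:P)).[y] != 0 /\
   v (\prod_(i <- r) (map_poly iota ('X - i%:P)).[y]) <= 0.
  by move=> [/eqP|]; [rewrite (negPf p0) | rewrite -gtz0_ge1 ltNge vp].
elim: r {rE} => [|a r [IHr vr]].
  by rewrite big_nil oner_eq0 (valuation1 dv).
have [ya va] := vy a; rewrite big_cons.
have -> : (map_poly iota ('X - a%:P)).[y] = y - iota a.
  by rewrite rmorphB /= map_polyX map_polyC !hornerE.
by rewrite mulf_neq0 // (valuationM dv) // -[0]addr0 lerD.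
Qed.

Lemma no_value_x_unique (P P' : curve iota) :
  ~ (exists c, has_value P x c) -> ~ (exists c, has_value P' x c) -> P = P'.
Proof.
have [v dv Pv] := pointP P; have [v' dv' Pv'] := pointP P'.
move=> NP NP'; apply: (infinity_unique dv Pv _ dv' Pv'); rewrite ltNge; apply/negP.
  by move/(center_x dv Pv).
by move/(center_x dv' Pv').
Qed.

Lemma finite_fiber c : finite_set [set P : curve iota | has_value P x c].
Proof.
pose S d := [set P : curve iota | has_value P x c /\ has_value P y d].
apply: sub_finite_set (_ : finite_set (\bigcup_(d in [set d | root ('X^N - f.[c]%:P) d]) S d)).
  move=> P xc; have [d yd dN] := center_y xc; exists d => //.
  by rewrite /= rootE !hornerE dN subrr.
apply: bigcup_finite => [|d]; first exact: finite_roots (monic_neq0 (monicXnsubC _ N_gt0)).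
rewrite /= rootE !hornerE subr_eq0 => /eqP dN.
apply: finite_subsingleton => P Q [Px Py] [Qx Qy].
exact: (affine_point_unique N_gt0 K_frac dN (@f_sep c) N_unit).
Qed.

(** Off the point at infinity and the fibres of x over the roots of the norms of numerator and
    denominator, both take nonzero values. *)
Lemma cofinite_value z : z != 0 ->
  finite_set [set P : curve iota | ~ exists2 c : k, c != 0 & has_value P z c].
Proof.
have [a [b [b0 ->]]] := fct_fraction K_frac z.
rewrite mulf_eq0 invr_eq0 (negPf b0) orbF => a0.
have [a' [g [g0 aE]]] := fct_norm N_gt0 K_frac a0.
have [b' [h [h0 bE]]] := fct_norm N_gt0 K_frac b0.
apply: sub_finite_set (_ : finite_set ([set P | ~ exists c, has_value P x c] `|`
  \bigcup_(c in [set c | root (g * h) c]) [set P | has_value P x c])); last first.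
  rewrite finite_setU; split; last first.
    apply: bigcup_finite; first by apply: finite_roots; rewrite mulf_neq0.
    by move=> c _; apply: finite_fiber.
  by apply: finite_subsingleton => P Q; apply: no_value_x_unique.
move=> P NP; have [[c xc]|] := pselect (exists c, has_value P x c); last by left.
right; exists c => //=; apply: contrapT => /negP gh; apply: NP.
have [d yd dN] := center_y xc.
have evE Q R p : fct Q * fct R = fct p%:P -> ev c d Q * ev c d R = p.[c].
  by rewrite -rmorphM => /(ev_fct N_gt0 K_frac dN); rewrite rmorphM evC.
move: gh; rewrite rootM negb_or !rootE -(evE _ _ _ aE) -(evE _ _ _ bE).
rewrite !mulf_eq0 !negb_or => /andP[/andP[eva _] /andP[evb _]].
exists (ev c d a / ev c d b); first by rewrite mulf_neq0 ?invr_eq0.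
by apply: has_valueM; [|apply: has_valueV => //]; apply: has_value_fct.
Qed.

(** Every element of the infinite field k is the value of x at some point. *)
Lemma infinite_curve : infinite_set [set: curve iota].
Proof.
move=> fin; apply: (@infinite_closed_field k).
pose xval (P : curve iota) : k := xget 0 [set c | has_value P x c].
apply: sub_finite_set (finite_image xval fin) => c _ /=.
have [|d] := @closed_rootP k ('X^N - f.[c]%:P) _.
  by rewrite size_XnsubC // eqSS -lt0n.
rewrite rootE !hornerE subr_eq0 => /eqP dN.
have [P [Px Py]] := affine_point_exists N_gt0 K_frac dN (@f_sep c) N_unit.
exists P => //; rewrite /xval; case: xgetP => [c' _ Pc'|/(_ c)//].
exact: has_value_uniq Pc' Px.
Qed.

End Centers.

(** * Rational functions of one variable *)

Section Pencils.
Variable k : fieldType.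
Implicit Types (p q f : {poly k}) (s : seq k).

(** The fibres of L = p / q over distinct values are disjoint. The coefficients come from expressing
    p and q in terms of p - a q and p - b q. *)
Lemma coprimep_pencil p q (a b : k) :
  coprimep p q -> a != b -> coprimep (p - a *: q) (p - b *: q).
Proof.
move=> /Bezout_eq1_coprimepP[[u v] /= uvE] ab; apply/Bezout_eq1_coprimepP.
have ab0 : a - b != 0 by rewrite subr_eq0.
exists ((a - b)^-1 *: (- b *: u - v), (a - b)^-1 *: (a *: u + v)) => /=.
rewrite -!scalerAl -scalerDr -uvE -[RHS]scale1r -(mulVf ab0) -scalerA; congr (_ *: _).
rewrite -!mul_polyC polyCB polyCN; ring.
Qed.

Lemma coprimep_pencil_r p q (a : k) : coprimep p q -> coprimep (p - a *: q) q.
Proof.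
move=> /Bezout_eq1_coprimepP[[u v] /= uvE]; apply/Bezout_eq1_coprimepP.
exists (u, v + a *: u) => /=; rewrite -uvE -!mul_polyC; ring.
Qed.

Lemma size_prod_const s (F : k -> {poly k}) d :
  (forall a, a \in s -> size (F a) = d.+1) ->
  size (\prod_(a <- s) F a) = (size s * d).+1.
Proof.
elim: s => [|a s IHs] Fs; first by rewrite big_nil size_poly1.
have IH := IHs (fun b bs => Fs b (mem_behead (s := a :: s) bs)).
rewrite big_cons size_mul -?size_poly_gt0 ?IH ?Fs ?mem_head //=.
by rewrite addnS mulSn.
Qed.

Lemma size_expS q n : q != 0 -> size (q ^+ n) = ((size q).-1 * n).+1.
Proof. by move=> q0; rewrite -size_exp prednK // size_poly_gt0 expf_neq0. Qed.

Lemma dvdp_coprime_const p q : p %| q -> coprimep p q -> size p = 1%N.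
Proof. by move=> /dvdp_gcd_idl /eqp_size <- /eqP. Qed.

Lemma coprimep_prod p s (F : k -> {poly k}) :
  (forall a, a \in s -> coprimep p (F a)) -> coprimep p (\prod_(a <- s) F a).
Proof.
move=> cp; rewrite big_seq; elim/big_rec: _ => [|a q /cp pa pq].
  exact: coprimep1.
by rewrite coprimepMr pa.
Qed.

(* With s' and s the roots of u and v, this is x = u(L) / v(L) for L = p / q,
   cleared of denominators. *)
Lemma pencil_fraction_degree p q s s' c : coprimep p q -> q != 0 -> c != 0 ->
  (forall a, a \in s -> a \notin s') ->
  'X * \prod_(a <- s) (p - a *: q) * q ^+ size s' =
     c *: (\prod_(a <- s') (p - a *: q) * q ^+ size s) ->
  (size p <= 2)%N /\ (size q <= 2)%N.
Proof.
move=> pq q0 c0 ss' E.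
(* Such a factor divides the right-hand side and is coprime to it. *)
have s_const a : a \in s -> size (p - a *: q) = 1%N.
  move=> sa; apply: (@dvdp_coprime_const _ (\prod_(a <- s') (p - a *: q) * q ^+ size s)).
    rewrite -(dvdpZr _ _ c0) -E -mulrA mulrCA.
    by apply: dvdp_mulr; rewrite (big_rem a sa) /=; apply: dvdp_mulr.
  rewrite coprimepMr coprimep_expr ?coprimep_pencil_r // andbT.
  apply: coprimep_prod => b s'b; apply: coprimep_pencil => //.
  by apply: contraTneq s'b => <-; apply: ss'.
(* If q is constant and p is not, no p - a q is constant, so s is empty and degrees give (deg p)
   |s'| = 1. *)
have [q1|q_gt1] := leqP (size q) 1.
  have sq : size q = 1%N by apply/eqP; rewrite eqn_leq q1 size_poly_gt0.
  have saq a : (size (a *: q) <= 1)%N by apply: leq_trans (size_scale_leq _ _) _.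
  split; last exact: leq_trans q1 _.
  have [p1|p_gt1] := leqP (size p) 1; first exact: leqW.
  have sp a : size (p - a *: q) = (size p).-1.+1.
    rewrite prednK ?(leq_trans _ p_gt1) // size_polyDl // size_polyN.
    exact: leq_ltn_trans p_gt1.
  case: s => [|a s] in s_const E ss' *; last first.
    by have := s_const a (mem_head _ _); rewrite sp; move: p_gt1; lia.
  have sqn n : size (q ^+ n) = 1%N by rewrite size_expS // sq.
  have := congr1 (fun p : {poly k} => size p) E.
  rewrite big_nil mulr1 expr0 mulr1 size_scale // (size_prod_const (d := (size p).-1)) //.
  rewrite size_mul ?polyX_eq0 ?expf_neq0 // sqn size_polyX /=.
  case: (size s') => [|[|n]]; first by rewrite mul0n.
    by rewrite mul1n => -[]; lia.
  by rewrite !mulSn => -[]; move: p_gt1; lia.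
case: s => [|r s] in s_const E ss' *.
  rewrite big_nil mulr1 expr0 mulr1 in E.
  case: s' => [|a s'] in E ss' *.
    have := congr1 (fun p : {poly k} => size p) E.
    by rewrite big_nil expr0 mulr1 size_polyX size_scale // size_poly1.
  have : size q = 1%N; last by move=> sq; rewrite sq in q_gt1.
  apply: (@dvdp_coprime_const _ (\prod_(a <- a :: s') (p - a *: q))).
    by rewrite -(dvdpZr _ _ c0) -E exprS mulrCA dvdp_mulr.
  by apply: coprimep_prod => b _; rewrite coprimep_sym coprimep_pencil_r.
(* As p - r q is the constant e, every other p - a q = e + (r - a) q has the degree of q. Comparing
   degrees gives deg q times the number of elements of s equal to 1. *)
have /size_poly1P[e e0 pE] : size (p - r *: q) == 1%N by rewrite s_const ?mem_head.
have saq a : a != r -> size (p - a *: q) = (size q).-1.+1.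
  move=> ar; rewrite -[p](subrK (r *: q)) pE -addrA -scalerBl addrC size_polyDl.
    by rewrite size_scale ?subr_eq0 1?eq_sym // prednK // (leq_trans _ q_gt1).
  by rewrite size_scale ?subr_eq0 1?eq_sym // (leq_trans _ q_gt1) // ltnS size_polyC_leq1.
have size1 := size_prod_const (d := 0) s_const.
have size2 : size (\prod_(a <- s') (p - a *: q)) = (size s' * (size q).-1).+1.
  apply: size_prod_const => a s'a; apply: saq; apply: contraTneq s'a => ->.
  by apply: ss'; rewrite mem_head.
have := congr1 (fun p : {poly k} => size p) E.
rewrite size_scale // mulrAC -mulrA.
have t1 : \prod_(a <- r :: s) (p - a *: q) != 0 by rewrite -size_poly_gt0 size1.
have t2 : \prod_(a <- s') (p - a *: q) != 0 by rewrite -size_poly_gt0 size2.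
rewrite !size_mul ?polyX_eq0 ?mulf_neq0 ?expf_neq0 // size1 size2 muln0.
rewrite size_polyX !size_expS //; case sq: (size q) q_gt1 => [//|d] d_gt0 /= e'.
have d1 : ((size s).+1 * d = 1)%N by move: e'; clear; nia.
have {}d1 : d = 1%N by move/eqP: d1; rewrite muln_eq1 => /andP[_ /eqP].
split; last by rewrite d1.
rewrite -[p](subrK (r *: q)) pE; apply: leq_trans (size_polyD _ _) _.
rewrite geq_max (leq_trans (size_polyC_leq1 _)) //=.
by apply: leq_trans (size_scale_leq _ _) _; rewrite sq d1.
Qed.

End Pencils.

(** * Multiplicities modulo N at the branch points *)

Section Ramification.
Variable k : fieldType.
Implicit Types (p q f g : {poly k}) (s : seq k).

Lemma mup_size2 g a : size g = 2%N -> root g a -> mup a g = 1%N.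
Proof.
move=> sg ga; have g0 : g != 0 by rewrite -size_poly_gt0 sg.
apply/eqP; rewrite eqn_leq mup_leq // -XsubC_dvd // dvdp_XsubCl ga andbT.
apply/negP => /(dvdp_leq g0).
by rewrite size_exp_XsubC sg.
Qed.

Lemma mupX a g n : g != 0 -> mup a (g ^+ n) = (n * mup a g)%N.
Proof.
move=> g0; elim: n => [|n IHn]; first by rewrite expr0 mupNroot // root1.
by rewrite exprS mupM ?expf_neq0 // IHn mulSn.
Qed.

Section BranchPoints.
Variables (rs : seq k) (N i : nat) (p q r s : {poly k}).
Hypotheses (rs_uniq : uniq rs) (rs_size : size rs = 3%N) (N_gt4 : (4 < N)%N).
Hypotheses (i_lt : (i < N)%N) (pq : coprimep p q) (q0 : q != 0).
Hypotheses (sp : (size p <= 2)%N) (sq : (size q <= 2)%N).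
Hypothesis pq_gt1 : (1 < size p)%N || (1 < size q)%N.
Hypotheses (r0 : r != 0) (s0 : s != 0).

Local Notation f := (\prod_(e <- rs) ('X - e%:P)).
Local Notation F := (\prod_(e <- rs) (p - e *: q)).
(* f(p / q) = (r / s)^N f^i, cleared of denominators. *)
Hypothesis E : r ^+ N * f ^+ i * q ^+ 3 = s ^+ N * F.

Lemma pencil_neq0 e : p - e *: q != 0.
Proof.
apply/eqP => pe0; have := coprimep_pencil_r e pq.
rewrite pe0 coprime0p -size_poly_eq1 => /eqP sq1.
move: pq_gt1; rewrite sq1 orbF ltnNge => /negP; apply.
by rewrite (subr0_eq pe0) (leq_trans (size_scale_leq _ _)) ?sq1.
Qed.

Lemma mup_equation a :
  (N * mup a r + i * (a \in rs) + 3 * mup a q = N * mup a s + mup a F)%N.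
Proof.
have F0 : F != 0 by rewrite prodf_seq_neq0; apply/allP => e _ /=; exact: pencil_neq0.
have f0 : f != 0 by rewrite monic_neq0 // monic_prod_XsubC.
have := congr1 (mup a) E; rewrite !mupM ?mulf_neq0 ?expf_neq0 // !mupX //.
by rewrite mu_prod_XsubC count_uniq_mem // => <-; rewrite !mulSn mul0n addn0.
Qed.

Lemma mup_pencil0 a : root q a -> mup a F = 0%N.
Proof.
move=> qa; apply: mupNroot; rewrite rootE horner_prod prodf_seq_neq0.
apply/allP => e _ /=; rewrite !hornerE (eqP qa) mulr0 subr0.
by apply: coprimep_root qa; rewrite coprimep_sym.
Qed.

Lemma mup_pencil1 a e : e \in rs -> size (p - e *: q) = 2%N ->
  root (p - e *: q) a -> mup a F = 1%N.
Proof.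
move=> rse se ea; rewrite (big_rem e rse) /= mupMl ?mup_size2 //.
rewrite rootE horner_prod prodf_seq_neq0.
apply/allP => e'; rewrite mem_rem_uniq // inE => /andP[ee' _] /=.
apply: coprimep_root ea; apply: coprimep_pencil => //.
by rewrite eq_sym.
Qed.

(** At such an a, q has order 0 and F order 1; modulo N, [mup_equation] becomes i [a in rs] = 1. *)
Lemma simple_branch_point a e : e \in rs -> size (p - e *: q) = 2%N ->
  root (p - e *: q) a -> a \in rs /\ i = 1%N.
Proof.
move=> rse se ea; have := mup_equation a; rewrite (mup_pencil1 rse se ea).
have qa : mup a q = 0%N.
  by apply: mupNroot; rewrite rootE; apply: coprimep_root ea; exact: coprimep_pencil_r.
rewrite qa muln0 addn0; case: (a \in rs) => e1.
  split=> //; move/(congr1 (modn^~ N)): e1.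
  rewrite muln1 ![(N * _)%N]mulnC !modnMDl !modn_small //; lia.
move/(congr1 (modn^~ N)): e1.
by rewrite muln0 addn0 ![(N * _)%N]mulnC modnMl modnMDl modn_small //; lia.
Qed.

Lemma pole_at_infinity : size q = 1%N.
Proof.
apply/eqP; rewrite eqn_leq size_poly_gt0 q0 andbT leqNgt; apply/negP => q_gt1.
have sq2 : size q = 2%N by apply/eqP; rewrite eqn_leq sq.
have [a qa] := poly2_root sq2.
have := mup_equation a; rewrite (mup_pencil0 qa) (mup_size2 sq2 qa) addn0 muln1.
move/(congr1 (modn^~ N)); rewrite -addnA ![(N * _)%N]mulnC modnMl modnMDl.
(* Only the value of L at infinity makes p - e q constant, so one of two distinct roots will do. *)
have [e rse se] : exists2 e, e \in rs & size (p - e *: q) = 2%N.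
  have se e : (size (p - e *: q)%R <= 2)%N.
    rewrite (leq_trans (size_polyD _ _)) // geq_max sp size_polyN.
    by rewrite (leq_trans (size_scale_leq _ _)).
  case: rs rs_uniq rs_size => [|e [|e' rs']] //= /andP[ee' _] _.
  have [s1|s1] := leqP (size (p - e *: q)) 1; last first.
    by exists e; rewrite ?mem_head //; apply/eqP; rewrite eqn_leq se.
  exists e'; first by rewrite !inE eqxx orbT.
  have ee'0 : e' - e != 0.
    by rewrite subr_eq0; apply: contraNneq ee' => ->; rewrite mem_head.
  have sd : size ((p - e *: q) - (p - e' *: q)) = 2%N.
    rewrite (_ : _ - _ = (e' - e) *: q) ?size_scale // -!mul_polyC polyCB; ring.
  apply/eqP; rewrite eqn_leq se /= ltnNge; apply/negP => s2.
  have := size_polyD (p - e *: q) (- (p - e' *: q)).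
  by rewrite sd size_polyN leqNgt ltnS geq_max s1 s2.
have [b eb] := poly2_root se.
have [_ ->] := simple_branch_point rse se eb.
(* With i = 1 the residue is 3 or 4 according to whether a is a root of f, and N > 4. *)
by case: (a \in rs); rewrite ?muln1 ?muln0 modn_small //; lia.
Qed.

(** Each p - e q is associate to some 'X - a with a in rs, and these factors are pairwise coprime;
    so F divides f, and the degrees agree. *)
Lemma affine_branch_points : exists2 c, c != 0 & F = c *: f.
Proof.
have sq1 := pole_at_infinity.
have sp2 : size p = 2%N.
  by move: pq_gt1; rewrite sq1 orbF => p1; apply/eqP; rewrite eqn_leq sp.
have se e : size (p - e *: q) = 2%N.
  rewrite size_polyDl // sp2 size_polyN.
  by apply: leq_ltn_trans (size_scale_leq _ _) _; rewrite sq1.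
suff : F %| f.
  have sF : size F = size f.
    by rewrite (size_prod_const (d := 1)) // size_prod_XsubC muln1.
  move=> Ff; have : F %= f by rewrite -dvdp_size_eqp // sF.
  case/eqpP=> -[c d] /= /andP[c0 d0] cd; exists (c^-1 * d).
    by rewrite mulf_neq0 ?invr_eq0.
  by rewrite -scalerA -cd scalerA mulVf // scale1r.
suff dvd_sub s' : uniq s' -> {subset s' <= rs} -> \prod_(e <- s') (p - e *: q) %| f.
  exact: dvd_sub.
elim: s' => [|e s' IHs]; first by rewrite big_nil dvd1p.
move=> /= /andP[es' us'] sub; rewrite big_cons Gauss_dvdp; last first.
  apply: coprimep_prod => e' s'e'; apply: coprimep_pencil => //.
  by apply: contraNneq es' => ->.
rewrite IHs // ?andbT; last by move=> e' s'e'; apply: sub; rewrite inE s'e' orbT.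
have [a ea] := poly2_root (se e).
have [rsa _] := simple_branch_point (sub e (mem_head _ _)) (se e) ea.
have : 'X - a%:P %= p - e *: q.
  rewrite -dvdp_size_eqp ?size_XsubC ?se //.
  by rewrite dvdp_XsubCl.
by move/eqp_dvdl <-; rewrite dvdp_XsubCl root_prod_XsubC.
Qed.

End BranchPoints.

End Ramification.

(** The coefficient of x^2 gives 3 a^2 b = 0, which kills the translation; the other coefficients
    are then read off. *)
Lemma affine_symmetry (k : fieldType) (B0 C0 a b c : k) :
  3%:R != 0 :> k -> a != 0 ->
  ('X^3 + B0 *: 'X + C0%:P) \Po (a *: 'X + b%:P) =
    c *: ('X^3 + B0 *: 'X + C0%:P) ->
  [/\ b = 0, c = a ^+ 3, B0 * a = c * B0 & C0 = c * C0].
Proof.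
move=> n3 a0.
rewrite !comp_polyD comp_polyZ comp_polyC comp_Xn_poly comp_polyX => E.
have cf n := congr1 (fun p : {poly k} => p`_n) E.
have E3 : (a *: 'X + b%:P) ^+ 3 = (a ^+ 3) *: 'X^3 + (3%:R * a ^+ 2 * b) *: 'X^2
   + (3%:R * a * b ^+ 2) *: 'X + (b ^+ 3)%:P.
  rewrite -!mul_polyC !(polyCM, polyC_exp, polyC_natr); ring.
have := cf 0%N; rewrite E3 !coefE /= !(mulr0, mulr1, addr0, add0r) => c0.
have := cf 1%N; rewrite E3 !coefE /= !(mulr0, mulr1, addr0, add0r) => c1.
have := cf 3%N; rewrite E3 !coefE /= !(mulr0, mulr1, addr0, add0r) => c3.
have := cf 2%N; rewrite E3 !coefE /= !(mulr0, mulr1, addr0, add0r) => /eqP.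
rewrite !mulf_eq0 (negPf n3) (negPf a0) /= => /eqP b0.
by move: c0 c1; rewrite b0 !expr0n /= !mulr0 !add0r => c0 c1; split.
Qed.

(** * Automorphisms of the superelliptic curve *)

Lemma rmorphism_of_morph (K : fieldType) (s : K -> K) :
  {morph s : a b / a + b} -> {morph s : a b / a * b} -> s 1 = 1 ->
  exists t : {rmorphism K -> K}, s =1 t.
Proof.
move=> sD sM s1.
have s0 : s 0 = 0 by apply: (addrI (s 0)); rewrite -sD !addr0.
have sB : {morph s : a b / a - b}.
  by move=> a b; apply: (addIr (s b)); rewrite -sD !subrK.
have sMM : monoid_morphism s by split.
pose t : {rmorphism K -> K} := HB.pack s
  (GRing.isZmodMorphism.Build K K s sB) (GRing.isMonoidMorphism.Build K K s sMM).
by exists t.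
Qed.

Lemma coprime_fraction (k : fieldType) (a b : {poly k}) : b != 0 ->
  exists p q, [/\ coprimep p q, q != 0 & a * q = p * b].
Proof.
move=> b0; pose d := gcdp a b.
have d0 : d != 0 by rewrite gcdp_eq0 negb_and b0 orbT.
have aE : a = a %/ d * d by rewrite divpK ?dvdp_gcdl.
have bE : b = b %/ d * d by rewrite divpK ?dvdp_gcdr.
exists (a %/ d), (b %/ d); split; first by rewrite coprimep_div_gcd ?b0 ?orbT.
  by apply: contraNneq b0 => bd0; rewrite bE bd0 mul0r.
by rewrite [in LHS]aE [in RHS]bE; ring.
Qed.

Opaque base_emb.

(** * Automorphisms acting diagonally on x and y *)

Section Diagonal.
Variables (k : closedFieldType) (f : {poly k}) (N : nat) (K : fieldType).
Variable j : {rmorphism coordinate_ring f N -> K}.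
Hypotheses (N_gt0 : (0 < N)%N) (K_frac : is_fraction_field j).
Hypothesis f_neq0 : f != 0.
Hypothesis Nm_coprime : coprime N (size f).-1.
Hypothesis f_sep : forall c, root f c -> ~~ root f^`() c.
Hypothesis N_unit : N%:R != 0 :> k.

Local Notation x := (coord_x j).
Local Notation y := (coord_y j).
Local Notation iota := (base_emb j).
Local Notation fct := (fct j).
Implicit Types (Q R T U V A B : {poly {poly k}}) (g p : {poly k}).

Let cof := cofinite_value N_gt0 K_frac f_neq0 Nm_coprime f_sep N_unit.
Let inf := infinite_curve N_gt0 K_frac f_sep N_unit.

Lemma pullback_rmorphism (phi : superelliptic_aut j) :
  exists s : {rmorphism K -> K}, is_pullback phi s.
Proof.
have [s sP] := exists_pullback cof inf phi.
have s1 : s 1 = 1 by rewrite -(rmorph1 iota) (pullback_cst cof inf _ sP).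
have [t st] := rmorphism_of_morph (pullbackD cof inf sP) (pullbackM cof inf sP) s1.
by exists t => P z c; rewrite sP st.
Qed.

Lemma pullback_iota (phi : superelliptic_aut j) (s : {rmorphism K -> K}) c :
  is_pullback phi s -> s (iota c) = iota c.
Proof. exact: (pullback_cst cof inf). Qed.

Lemma aut_ext (phi psi : superelliptic_aut j) (s t : K -> K) :
  is_pullback phi s -> is_pullback psi t -> s x = t x -> s y = t y -> phi = psi.
Proof.
move=> sP tP stx sty; apply: curve_autP => P.
have eqx c : has_value (phi P) x c <-> has_value (psi P) x c by rewrite sP tP stx.
have eqy c : has_value (phi P) y c <-> has_value (psi P) y c by rewrite sP tP sty.
have [[c xc]|Nx] := pselect (exists c, has_value (phi P) x c); last first.
  apply: (no_value_x_unique N_gt0 K_frac f_neq0 Nm_coprime Nx) => -[c /eqx xc].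
  by apply: Nx; exists c.
have [d yd dN] := center_y N_gt0 xc.
apply: (affine_point_unique N_gt0 K_frac dN (@f_sep c) N_unit xc yd).
  exact/eqx.
exact/eqy.
Qed.

(** A diagonal action is prescribed only where x and y have values; this leaves out finitely many
    points, so it determines s x and s y. *)
Lemma diagonal_pullback a b (phi : superelliptic_aut j) s :
  is_pullback phi s ->
  diagonal_action a b phi <-> s x = iota a * x /\ s y = iota b * y.
Proof.
move=> sP; split=> [ab|[sx sy] P c d xc yd]; last first.
  split; apply/sP; rewrite ?sx ?sy; apply: has_valueM => //; exact: has_value_cst.
have finS := finite_no_value cof x.
split; apply: (pullback_unique cof inf sP finS) => P e /contrapT[c xc].
  have [d yd _] := center_y N_gt0 xc; have [xc' _] := ab P c d xc yd.
  move/(has_value_uniq xc') <-; apply: has_valueM => //; exact: has_value_cst.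
have [d yd _] := center_y N_gt0 xc; have [_ yd'] := ab P c d xc yd.
move/(has_value_uniq yd') <-; apply: has_valueM => //; exact: has_value_cst.
Qed.

Lemma diagonal_unique a b (phi psi : superelliptic_aut j) :
  diagonal_action a b phi -> diagonal_action a b psi -> phi = psi.
Proof.
have [s sP] := pullback_rmorphism phi; have [t tP] := pullback_rmorphism psi.
move=> /(diagonal_pullback _ _ sP)[sx sy] /(diagonal_pullback _ _ tP)[tx ty].
by apply: aut_ext sP tP _ _; rewrite ?sx ?tx ?sy ?ty.
Qed.

Lemma diagonal_inj a b a' b' (phi : superelliptic_aut j) :
  diagonal_action a b phi -> diagonal_action a' b' phi -> a = a' /\ b = b'.
Proof.
have [s sP] := pullback_rmorphism phi.
move=> /(diagonal_pullback _ _ sP)[sx sy] /(diagonal_pullback _ _ sP)[sx' sy'].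
split; apply: (fmorph_inj iota).
  by apply: (mulIf (coord_x_neq0 N_gt0 K_frac)); rewrite -sx.
by apply: (mulIf (coord_y_neq0 N_gt0 K_frac f_neq0)); rewrite -sy.
Qed.

Lemma diagonal_mul a b a' b' (phi psi : superelliptic_aut j) :
  diagonal_action a b phi -> diagonal_action a' b' psi ->
  diagonal_action (a * a') (b * b') (phi * psi)%g.
Proof.
move=> ab ab' P c d xc yd; have [xc' yd'] := ab' P c d xc yd.
by rewrite -!mulrA; apply: ab.
Qed.

Lemma diagonal1 : diagonal_action 1 1 (1%g : superelliptic_aut j).
Proof. by move=> P c d xc yd; rewrite !mul1r. Qed.

Lemma diagonalX a b (phi : superelliptic_aut j) n :
  diagonal_action a b phi -> diagonal_action (a ^+ n) (b ^+ n) (phi ^+ n)%g.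
Proof.
move=> ab; elim: n => [|n IHn]; first by rewrite expg0; apply: diagonal1.
by rewrite expgS !exprS; apply: diagonal_mul.
Qed.

Lemma fctE Q (s : {rmorphism K -> K}) : (forall c, s (iota c) = iota c) ->
  s (fct Q) = (map_poly (fun p => (map_poly iota p).[s x]) Q).[s y].
Proof.
move=> s_iota; pose F := horner_eval (s x) \o map_poly iota.
rewrite -[(fun p => _)]/(F : _ -> _).
have sC p : s (fct p%:P) = F p.
  rewrite (fctC j N_gt0) -horner_map -map_poly_comp /=.
  by congr (_.[_]); apply: eq_map_poly => c /=; rewrite s_iota.
elim/poly_ind: Q => [|Q p IHQ]; first by rewrite !rmorph0 horner0.
rewrite !rmorphD !rmorphM /= fctX map_polyX map_polyC !hornerE -IHQ.
by rewrite sC.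
Qed.

Lemma rmorphism_ext (s t : {rmorphism K -> K}) :
  (forall c, s (iota c) = iota c) -> (forall c, t (iota c) = iota c) ->
  s x = t x -> s y = t y -> s =1 t.
Proof.
move=> s_iota t_iota stx sty z.
have [A [B [_ ->]]] := fct_fraction K_frac z.
have st Q : s (fct Q) = t (fct Q).
  by rewrite (fctE Q s_iota) stx sty -(fctE Q t_iota).
by rewrite [LHS]fmorph_div [RHS]fmorph_div [s (fct A)]st [s (fct B)]st.
Qed.

(** Substituting (a x, b y) in polynomials kills the equation by the hypothesis on f; it extends to
    fractions once nonzero functions keep nonzero images. *)
Lemma diagonal_rmorphism a b : a != 0 -> f \Po (a *: 'X) = b ^+ N *: f ->
  exists s : {rmorphism K -> K}, [/\ forall c, s (iota c) = iota c,
    s x = iota a * x & s y = iota b * y].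
Proof.
move=> a0 fab.
pose F0 : {rmorphism {poly k} -> K} := horner_eval (iota a * x) \o map_poly iota.
pose F : {rmorphism {poly {poly k}} -> K} :=
  horner_eval (iota b * y) \o map_poly F0.
have F0D p : F0 p = (map_poly iota p).[iota a * x] by [].
have FD Q : F Q = (map_poly F0 Q).[iota b * y] by [].
have F0E p : F0 p = fct (p \Po (a *: 'X))%:P.
  have aX : fct (a *: 'X)%:P = iota a * x.
    by rewrite -mul_polyC polyCM rmorphM /= (fctCC j N_gt0) (fctCX j N_gt0).
  elim/poly_ind: p => [|p c IHp]; first by rewrite comp_poly0 !rmorph0.
  rewrite comp_poly_MXaddC polyCD polyCM.
  rewrite [LHS]rmorphD [RHS]rmorphD [F0 (_ * _)]rmorphM [X in _ = X + _]rmorphM.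
  congr (_ * _ + _); first exact: IHp.
    by rewrite [RHS]aX F0D map_polyX hornerX.
  by rewrite [RHS](fctCC j N_gt0) F0D map_polyC hornerC.
have FC p : F p%:P = F0 p by rewrite FD map_polyC hornerC.
have FX : F 'X = iota b * y by rewrite FD map_polyX hornerX.
have Fh : F ('X^N - f%:P) = 0.
  rewrite rmorphB rmorphXn FX FC F0E fab exprMn (curve_equation j N_gt0).
  by rewrite -mul_polyC polyCM rmorphM /= (fctCC j N_gt0) rmorphXn /= subrr.
have F_eq Q R : fct Q = fct R -> F Q = F R.
  move=> /(fct_eq N_gt0 K_frac)[S ->].
  by rewrite [LHS]rmorphD [F (S * _)]rmorphM Fh mulr0 addr0.
(* F Q divides the image of the norm of Q, which is g(a x), nonzero since a != 0. *)
have F_neq0 Q : fct Q != 0 -> F Q != 0.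
  move=> /(fct_norm N_gt0 K_frac)[R [g [g0]]].
  rewrite -rmorphM => /F_eq; rewrite rmorphM FC F0E => FQR.
  suff : F Q * F R != 0 by rewrite mulf_eq0 negb_or => /andP[].
  rewrite FQR fctC_eq0 // comp_poly2_eq0 //.
  by rewrite size_scale // size_polyX.
have /choice [s sP] z : exists w, forall A B, fct B != 0 -> z = fct A / fct B ->
    w = F A / F B.
  have [A [B [B0 ->]]] := fct_fraction K_frac z; exists (F A / F B) => A' B' B'0 e.
  apply/eqP; rewrite eqr_div ?F_neq0 // -!rmorphM; apply/eqP/F_eq.
  by rewrite !rmorphM; apply/eqP; rewrite -eqr_div // e.
have s_fct Q : s (fct Q) = F Q.
  by rewrite (sP _ Q 1) ?rmorph1 ?divr1 ?oner_eq0.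
have sD : {morph s : z w / z + w}.
  move=> z w; have [A [B [B0 zE]]] := fct_fraction K_frac z.
  have [A' [B' [B'0 wE]]] := fct_fraction K_frac w.
  rewrite (sP z A B) // (sP w A' B') // addf_div ?F_neq0 // -!rmorphM -rmorphD.
  apply: sP; first by rewrite rmorphM mulf_neq0.
  by rewrite zE wE addf_div // -!rmorphM -rmorphD.
have sM : {morph s : z w / z * w}.
  move=> z w; have [A [B [B0 zE]]] := fct_fraction K_frac z.
  have [A' [B' [B'0 wE]]] := fct_fraction K_frac w.
  rewrite (sP z A B) // (sP w A' B') // mulf_div -!rmorphM.
  apply: sP; first by rewrite rmorphM mulf_neq0.
  by rewrite zE wE mulf_div -!rmorphM.
have s1 : s 1 = 1.
  by rewrite -[in LHS](rmorph1 fct) s_fct [LHS]rmorph1.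
have [t st] := rmorphism_of_morph sD sM s1.
exists t; split=> [c||]; rewrite -st.
- rewrite -(fctCC j N_gt0) s_fct FC F0E comp_polyC (fctCC j N_gt0) //.
- by rewrite -{1}(fctCX j N_gt0) s_fct FC F0D map_polyX hornerX.
- by rewrite -{1}(fctX j) s_fct FX.
Qed.

Lemma diagonal_exists a b : a != 0 -> b != 0 -> f \Po (a *: 'X) = b ^+ N *: f ->
  exists phi : superelliptic_aut j, diagonal_action a b phi.
Proof.
move=> a0 b0 fab; have [s [s_iota sx sy]] := diagonal_rmorphism a0 fab.
have fab' : f \Po (a^-1 *: 'X) = b^-1 ^+ N *: f.
  have fE : f = b^-1 ^+ N *: (f \Po (a *: 'X)).
    by rewrite fab scalerA -exprMn mulVf // expr1n scale1r.
  rewrite [in LHS]fE comp_polyZ -comp_polyA comp_polyZ comp_polyX scalerA mulfV //.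
  by rewrite scale1r comp_polyXr.
have a'0 : a^-1 != 0 by rewrite invr_eq0.
have [t [t_iota tx ty]] := diagonal_rmorphism a'0 fab'.
have sK : cancel s t.
  apply: (@rmorphism_ext (t \o s) idfun) => [c|//||] /=.
  - by rewrite s_iota t_iota.
  - by rewrite sx rmorphM t_iota tx mulrA -rmorphM mulfV // rmorph1 mul1r.
  - by rewrite sy rmorphM t_iota ty mulrA -rmorphM mulfV // rmorph1 mul1r.
have tK : cancel t s.
  apply: (@rmorphism_ext (s \o t) idfun) => [c|//||] /=.
  - by rewrite t_iota s_iota.
  - by rewrite tx rmorphM s_iota sx mulrA -rmorphM mulVf // rmorph1 mul1r.
  - by rewrite ty rmorphM s_iota sy mulrA -rmorphM mulVf // rmorph1 mul1r.
have [phi phiP] := curve_aut_of_field_aut (rmorphD s) (rmorphM s) s_iota sK tK.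
by exists phi; apply/(diagonal_pullback a b phiP).
Qed.

End Diagonal.

(** * Eigenvectors of delta and the degree of L *)

Section Semilinear.
Variables (k : closedFieldType) (f : {poly k}) (N : nat) (K : fieldType).
Variable j : {rmorphism coordinate_ring f N -> K}.
Hypotheses (N_gt4 : (4 < N)%N) (K_frac : is_fraction_field j).
Hypothesis f_neq0 : f != 0.

Local Notation x := (coord_x j).
Local Notation y := (coord_y j).
Local Notation iota := (base_emb j).
Local Notation fct := (fct j).
Implicit Types (Q R T U V A B : {poly {poly k}}) (g p q u v : {poly k}).

Let N_gt0 : (0 < N)%N. Proof. exact: leq_trans N_gt4. Qed.

Definition fctx p : K := fct p%:P.

HB.instance Definition _ := GRing.RMorphism.copy fctx (fct \o polyC).

Lemma fctx_eq0 p : (fctx p == 0) = (p == 0).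
Proof. exact: fctC_eq0. Qed.

Lemma fctx_inj : injective fctx.
Proof. by move=> p q; apply: fctC_inj. Qed.

Lemma fctxX : fctx 'X = x.
Proof. exact: fctCX. Qed.

Lemma fctxC c : fctx c%:P = iota c.
Proof. exact: fctCC. Qed.

Lemma fctxM p q : fctx (p * q) = fctx p * fctx q.
Proof. exact: rmorphM. Qed.

Lemma fctxXn p n : fctx (p ^+ n) = fctx p ^+ n.
Proof. exact: rmorphXn. Qed.

Lemma fctxZ c p : fctx (c *: p) = iota c * fctx p.
Proof. by rewrite -mul_polyC rmorphM /= fctxC. Qed.

Lemma rmorphism_fctx (s : {rmorphism K -> K}) p :
  (forall c, s (iota c) = iota c) -> s (fctx p) = (map_poly iota p).[s x].
Proof.
move=> s_iota; rewrite /fctx (fctC j N_gt0) -horner_map -map_poly_comp /=.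
by congr (_.[_]); apply: eq_map_poly => c /=; rewrite s_iota.
Qed.

(** D fixes k(x) and multiplies y^l by xi^l; these scalars are distinct for l < N, so only the term
    in y^i survives in the numerator of z. *)
Lemma eigenvector (xi : k) (D : {rmorphism K -> K}) i z :
  N.-primitive_root xi -> (forall c, D (iota c) = iota c) ->
  D x = x -> D y = iota xi * y -> (i < N)%N -> D z = iota (xi ^+ i) * z ->
  exists a g, g != 0 /\ z = fctx a * y ^+ i / fctx g.
Proof.
move=> xi_prim D_iota Dx Dy iN Dz.
have [A [g [sA g0 zE]]] := fct_fraction_poly N_gt0 K_frac z.
have Dfctx p : D (fctx p) = fctx p.
  by rewrite rmorphism_fctx // Dx /fctx (fctC j N_gt0).
have g1 : fctx g != 0 by rewrite fctx_eq0.
have DA : D (fct A) = iota (xi ^+ i) * fct A.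
  have -> : fct A = z * fctx g by rewrite zE divfK.
  by rewrite [LHS]rmorphM Dz [D (fctx g)]Dfctx mulrA.
exists A`_i, g; split=> //.
have Al (l : 'I_N) : nat_of_ord l != i -> A`_l = 0.
  move=> li.
  (* C represents D(A) - xi^i A, which is zero. *)
  pose C := \poly_(l < N) ((xi ^+ l - xi ^+ i) *: A`_l).
  have C0 : C = 0.
    apply: (fct_small_eq0 N_gt0 K_frac (size_poly _ _)).
    rewrite (fct_sum j (size_poly _ _)).
    transitivity (D (fct A) - iota (xi ^+ i) * fct A); last by rewrite DA subrr.
    rewrite (fct_sum j sA) rmorph_sum mulr_sumr -sumrB; apply: eq_bigr => m _.
    rewrite coef_poly ltn_ord -/(fctx _) -/(fctx _) fctxZ /=.
    rewrite [D _]rmorphM Dfctx [D (_ ^+ _)]rmorphXn /= Dy exprMn rmorphB !rmorphXn /=; ring.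
  have /eqP : C`_l = 0 by rewrite C0 coef0.
  rewrite coef_poly ltn_ord scaler_eq0 subr_eq0 (eq_prim_root_expr xi_prim).
  by rewrite !modn_small // (negPf li) => /eqP.
rewrite zE (fct_sum j sA) (bigD1 (Ordinal iN)) //= big1 ?addr0 // => l li.
by rewrite Al ?rmorph0 ?mul0r.
Qed.

Lemma horner_fraction p q s c : q != 0 ->
  (map_poly iota (c *: \prod_(e <- s) ('X - e%:P))).[fctx p / fctx q] *
    fctx q ^+ size s = iota c * fctx (\prod_(e <- s) (p - e *: q)).
Proof.
move=> q0; have q1 : fctx q != 0 by rewrite fctx_eq0.
elim: s => [|e s IHs].
  by rewrite !big_nil expr0 mulr1 rmorph1 -mul_polyC mulr1 map_polyC hornerC mulr1.
have fe : fctx (p - e *: q) = (fctx p / fctx q - iota e) * fctx q.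
  by rewrite mulrBl divfK // rmorphB /= fctxZ.
rewrite !big_cons scalerAr fctxM mulrCA -IHs fe rmorphM hornerM.
rewrite rmorphB /= map_polyX map_polyC hornerXsubC exprS; ring.
Qed.

(** Here u / v is the image of x under the inverse of s. Splitting u and v into linear factors turns
    x = u(L) / v(L) into the identity of [pencil_fraction_degree]. *)
Lemma invertible_degree p q u v (s : {rmorphism K -> K}) :
  (forall c, s (iota c) = iota c) -> coprimep p q -> q != 0 -> coprimep u v ->
  v != 0 -> s x = fctx p / fctx q -> s (fctx u / fctx v) = x ->
  (size p <= 2)%N /\ (size q <= 2)%N.
Proof.
move=> s_iota pq q0 uv v0 sx suv.
have q1 : fctx q != 0 by rewrite fctx_eq0.
have [ru uE] := closed_field_poly_normal u.
have [rv vE] := closed_field_poly_normal v.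
have x0 : x != 0 := coord_x_neq0 N_gt0 K_frac.
have u0 : u != 0.
  by apply: contraNneq x0 => u0; rewrite -suv u0 !rmorph0 mul0r rmorph0.
have sv0 : s (fctx v) != 0 by rewrite fmorph_eq0 fctx_eq0.
have suvE : s (fctx u) = x * s (fctx v) by rewrite -suv [s (_ / _)]fmorph_div divfK.
have su := horner_fraction p ru (lead_coef u) q0.
have sv := horner_fraction p rv (lead_coef v) q0.
rewrite -uE -sx -rmorphism_fctx // in su.
rewrite -vE -sx -rmorphism_fctx // in sv.
have lu0 : lead_coef u != 0 by rewrite lead_coef_eq0.
have lv0 : lead_coef v != 0 by rewrite lead_coef_eq0.
apply: (@pencil_fraction_degree _ p q rv ru (lead_coef u / lead_coef v)) => //.
- by rewrite mulf_neq0 ?invr_eq0.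
- move=> a rva; apply/negP => rua.
  have ra : root u a by rewrite uE rootZ // root_prod_XsubC.
  by have := coprimep_root uv ra; rewrite -rootE vE rootZ // root_prod_XsubC rva.
apply: (@scalerI _ _ (lead_coef v) lv0); rewrite scalerA mulrCA mulfV // mulr1.
apply: fctx_inj; rewrite !fctxZ !fctxM !rmorphXn /= fctxX.
transitivity (x * (iota (lead_coef v) * fctx (\prod_(e <- rv) (p - e *: q))) *
  fctx q ^+ size ru); first ring.
rewrite -sv; transitivity (x * s (fctx v) * fctx q ^+ size rv * fctx q ^+ size ru).
  by ring.
by rewrite -suvE mulrAC su mulrA.
Qed.

End Semilinear.

(** * Pull-backs of the form x -> L(x), y -> g(x) y^i are diagonal *)

Section SemilinearDiagonal.
Variables (k : closedFieldType) (f : {poly k}) (N : nat) (K : fieldType).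
Variable j : {rmorphism coordinate_ring f N -> K}.
Hypotheses (N_gt4 : (4 < N)%N) (K_frac : is_fraction_field j).
Hypothesis f_neq0 : f != 0.
Variables (rs : seq k) (B0 C0 : k).
Hypotheses (rs_uniq : uniq rs) (rs_size : size rs = 3%N).
Hypothesis f_split : f = \prod_(e <- rs) ('X - e%:P).
Hypothesis f_eq : f = 'X^3 + B0 *: 'X + C0%:P.
Hypothesis three_unit : 3%:R != 0 :> k.

Local Notation x := (coord_x j).
Local Notation y := (coord_y j).
Local Notation iota := (base_emb j).
Local Notation fct := (fct j).
Local Notation fctx := (fctx j).

Let N_gt0 : (0 < N)%N. Proof. exact: leq_trans N_gt4. Qed.

Lemma fctx_comp (g l : {poly k}) : (map_poly iota g).[fctx l] = fctx (g \Po l).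
Proof.
elim/poly_ind: g => [|g c IHg].
  by rewrite comp_poly0 rmorph0 horner0 /fctx !rmorph0.
rewrite comp_poly_MXaddC rmorphD rmorphM /= map_polyX map_polyC !hornerE IHg.
by rewrite [RHS]rmorphD /= fctxM // fctxC.
Qed.

(** X^N - c splits over k, so its roots in K already lie in k. *)
Lemma root_of_scalar (w : K) (c : k) : w ^+ N = iota c ->
  exists2 b, w = iota b & b ^+ N = c.
Proof.
move=> wN; have [r rE] := closed_field_poly_normal ('X^N - c%:P).
have lc1 : lead_coef ('X^N - c%:P) = 1.
  by apply/eqP; rewrite -monicE monicXnsubC.
rewrite lc1 scale1r in rE.
have : (map_poly iota ('X^N - c%:P)).[w] = 0.
  by rewrite rmorphB /= map_polyXn map_polyC !hornerE wN subrr.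
rewrite rE rmorph_prod horner_prod => /eqP; rewrite prodf_seq_eq0.
case/hasP=> b rb /=; rewrite rmorphB /= map_polyX map_polyC hornerXsubC subr_eq0.
move/eqP=> ->; exists b => //.
have : root ('X^N - c%:P) b by rewrite rE root_prod_XsubC.
by rewrite rootE !hornerE subr_eq0 => /eqP.
Qed.

Variables (p q r s : {poly k}) (i : nat) (S : {rmorphism K -> K}).
Hypothesis S_iota : forall c, S (iota c) = iota c.
Hypotheses (pq : coprimep p q) (q0 : q != 0) (r0 : r != 0) (s0 : s != 0).
Hypotheses (sp : (size p <= 2)%N) (sq : (size q <= 2)%N).
Hypothesis pq_gt1 : (1 < size p)%N || (1 < size q)%N.
Hypotheses (i_lt : (i < N)%N).
Hypothesis Sx : S x = fctx p / fctx q.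
Hypothesis Sy : S y = fctx r * y ^+ i / fctx s.

(** This is S applied to y^N = f(x), with denominators cleared. *)
Lemma semilinear_branch_points :
  r ^+ N * f ^+ i * q ^+ 3 = s ^+ N * \prod_(e <- rs) (p - e *: q).
Proof.
apply: (fctx_inj N_gt4 K_frac).
have s1 : fctx s != 0 by rewrite fctx_eq0.
have h := horner_fraction N_gt4 K_frac p rs 1 q0.
rewrite scale1r -f_split -Sx -rmorphism_fctx // rmorph1 mul1r rs_size in h.
have yN : fctx f = y ^+ N by rewrite curve_equation.
have Sys : fctx s * S y = fctx r * y ^+ i by rewrite Sy mulrC divfK.
rewrite !(fctxM, fctxXn) -h yN [S (y ^+ N)]rmorphXn [RHS]mulrA -exprMn Sys exprMn.
by rewrite -!exprM mulnC.
Qed.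

Lemma semilinear_diagonal : exists a b, [/\ a != 0, b ^+ N = a ^+ 3,
  S x = iota a * x /\ S y = iota b * y, B0 * a = a ^+ 3 * B0 & C0 = a ^+ 3 * C0].
Proof.
have E := semilinear_branch_points.
rewrite f_split in E.
have [c c0 FE] := affine_branch_points rs_uniq rs_size N_gt4 i_lt pq q0 sp sq
  pq_gt1 r0 s0 E.
have sq1 := pole_at_infinity rs_uniq rs_size N_gt4 i_lt pq q0 sp sq
  pq_gt1 r0 s0 E.
have sp2 : size p = 2%N.
  by move: pq_gt1; rewrite sq1 orbF => p1; apply/eqP; rewrite eqn_leq sp.
have /size_poly1P[d d0 qE] : size q == 1%N by rewrite sq1.
have [l l_def] : exists l, l = d^-1 *: p by exists (d^-1 *: p).
have sl : size l = 2%N by rewrite l_def size_scale ?invr_eq0.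
have Sxl : S x = fctx l.
  by rewrite l_def Sx qE fctxC // fctxZ // fmorphV mulrC.
have lE : l = l`_1 *: 'X + (l`_0)%:P.
  apply/polyP => -[|[|n]]; rewrite !coefE /= ?mulr0 ?add0r ?mulr1 ?addr0 //.
  by rewrite nth_default // sl.
have a0 : l`_1 != 0.
  have : lead_coef l != 0 by rewrite lead_coef_eq0 -size_poly_eq0 sl.
  by rewrite lead_coefE sl.
(* From f(L) q^3 = c f with q the constant d, one gets f(L) = g f. *)
pose g := d^-1 ^+ 3 * c.
have d1 : iota d ^+ 3 != 0 by rewrite expf_neq0 // fmorph_eq0.
have SfE : S (fctx f) = iota g * fctx f.
  have := horner_fraction N_gt4 K_frac p rs 1 q0.
  rewrite scale1r -f_split -Sx -rmorphism_fctx // rmorph1 mul1r rs_size FE.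
  rewrite -f_split fctxZ // qE fctxC // => Sf.
  by apply: (mulIf d1); rewrite Sf rmorphM rmorphXn /= fmorphV; field; rewrite fmorph_eq0.
have fl : f \Po l = g *: f.
  apply: (fctx_inj N_gt4 K_frac); rewrite fctxZ // -SfE.
  by rewrite rmorphism_fctx // Sxl fctx_comp.
have := fl; rewrite [in f \Po _]f_eq [in _ *: f]f_eq [X in _ \Po X]lE.
move=> /(affine_symmetry three_unit a0)[b0 gE B0E C0E].
have y0 : y != 0 := coord_y_neq0 N_gt0 K_frac f_neq0.
have yN : fctx f = y ^+ N by rewrite curve_equation.
(* The N-th power of S y / y is S(f) / f = g, a constant. *)
have [b wE bN] : exists2 b, S y / y = iota b & b ^+ N = g.
  apply: root_of_scalar; rewrite expr_div_n -rmorphXn /= -yN SfE yN mulfK //.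
  by rewrite expf_neq0.
exists l`_1, b; rewrite -gE; split=> //; split.
  by rewrite Sxl [X in fctx X]lE b0 addr0 fctxZ // fctxX.
by rewrite -wE divfK.
Qed.

End SemilinearDiagonal.

(** * The normalizer *)

Section CyclicGroups.
Variable G : groupType.
Local Open Scope group_scope.
Implicit Types g h : G.

Lemma cyclic_subgroup_expg g n h : (0 < n)%N -> g ^+ n = 1 ->
  cyclic_subgroup g h -> exists m, h = g ^+ m.
Proof.
move=> n_gt0 gn [m [->|->]]; first by exists m.
exists (m * n.-1)%N; apply: mulg1_eq.
by rewrite -expgnDr -mulnS prednK // mulnC expgnA gn expg1n.
Qed.

Lemma commute_normalizer g h : commute h g -> normalizer (cyclic_subgroup g) h.
Proof.
move=> hg; have fix_h c : cyclic_subgroup g c -> c ^ h = c.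
  have gh := commute_sym hg.
  move=> [n [->|->]]; apply/conjg_fixP/commgP/commute_sym.
    exact: commuteX.
  by apply/commuteV/commuteX.
apply/seteqP; split=> [_ [c Cc <-]|c Cc]; first by rewrite fix_h.
by exists c => //; apply: fix_h.
Qed.

Lemma isom_cyclic g n : (1 < n)%N ->
  (forall m, g ^+ m = 1 <-> (n %| m)%N) -> isom_Zmod n (cyclic_subgroup g).
Proof.
move=> n_gt1 ord_g; have gn : g ^+ n = 1 by apply/ord_g.
have n_gt0 : (0 < n)%N by apply: ltnW.
have g_mod m : g ^+ (m %% n) = g ^+ m.
  by rewrite [in RHS](divn_eq m n) expgnDr mulnC expgnA gn expg1n mul1g.
exists (fun a : 'Z_n => g ^+ a); split.
- suff le_inj (a b : 'Z_n) : (a <= b)%N -> g ^+ a = g ^+ b -> a = b.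
    move=> a b gab; have [ab|/ltnW ba] := leqP a b; first exact: le_inj.
    by apply/esym/le_inj.
  move=> ab gab; apply/val_inj/eqP; rewrite eqn_leq ab /=.
  have : g ^+ (b - a) = 1 by rewrite expgnFr // gab mulgV.
  move/ord_g/dvdn_leq; case: posnP => [/eqP|_ /(_ isT)]; first by rewrite subn_eq0.
  by have := ltn_ord b; rewrite [X in (_ < X)%N -> _]Zp_cast //; lia.
- by move=> a b; rewrite /= -expgnDr [X in g ^+ (_ %% X)]Zp_cast // g_mod.
apply/seteqP; split=> [_ [a _ <-]|h /(cyclic_subgroup_expg n_gt0 gn)[m ->]].
  by exists a; left.
exists (inZp m) => //=; rewrite [X in g ^+ (_ %% X)]Zp_cast //; exact: g_mod.
Qed.

End CyclicGroups.

Section Normalizer.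
Variables (k : closedFieldType) (f : {poly k}) (N : nat) (K : fieldType).
Variable j : {rmorphism coordinate_ring f N -> K}.
Hypotheses (N_gt4 : (4 < N)%N) (K_frac : is_fraction_field j).
Hypothesis f_neq0 : f != 0.
Hypothesis Nm_coprime : coprime N (size f).-1.
Hypothesis f_sep : forall c, root f c -> ~~ root f^`() c.
Hypothesis N_unit : N%:R != 0 :> k.
Variables (rs : seq k) (B0 C0 : k).
Hypotheses (rs_uniq : uniq rs) (rs_size : size rs = 3%N).
Hypothesis f_split : f = \prod_(e <- rs) ('X - e%:P).
Hypothesis f_eq : f = 'X^3 + B0 *: 'X + C0%:P.
Hypothesis three_unit : 3%:R != 0 :> k.
Variables (xi : k) (delta : superelliptic_aut j).
Hypothesis xi_prim : N.-primitive_root xi.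
Hypothesis delta_diag : diagonal_action 1 xi delta.

Local Notation x := (coord_x j).
Local Notation y := (coord_y j).
Local Notation iota := (base_emb j).
Local Notation fctx := (fctx j).

Let N_gt0 : (0 < N)%N. Proof. exact: leq_trans N_gt4. Qed.

Let diag_unique := diagonal_unique N_gt0 K_frac f_neq0 Nm_coprime f_sep N_unit.
Let pullback := pullback_rmorphism N_gt0 K_frac f_neq0 Nm_coprime f_sep N_unit.
Let pullback_diag := diagonal_pullback N_gt0 K_frac f_neq0 Nm_coprime f_sep N_unit.
Let pull_iota := pullback_iota N_gt0 K_frac f_neq0 Nm_coprime f_sep N_unit.
Let cof := cofinite_value N_gt0 K_frac f_neq0 Nm_coprime f_sep N_unit.
Let inf := infinite_curve N_gt0 K_frac f_sep N_unit.

Lemma delta_order : (delta ^+ N)%g = 1%g.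
Proof.
apply: diag_unique (diagonalX N delta_diag) _.
by rewrite expr1n (prim_expr_order xi_prim); apply: diagonal1.
Qed.

Lemma coprime_fctx_fraction a b : b != 0 -> exists p q : {poly k},
  [/\ coprimep p q, q != 0 & fctx a / fctx b = fctx p / fctx q].
Proof.
move=> b0; have [p [q [pq q0 e]]] := coprime_fraction a b0.
exists p, q; split=> //; apply/eqP.
by rewrite eqr_div ?fctx_eq0 // -!rmorphM /= e.
Qed.

Lemma normalizer_diagonal g : normalizer (cyclic_subgroup delta) g ->
  exists a b, [/\ diagonal_action a b g, a != 0, b ^+ N = a ^+ 3,
    B0 * a = a ^+ 3 * B0 & C0 = a ^+ 3 * C0].
Proof.
move=> Hg; have delta_in : cyclic_subgroup delta delta by exists 1%N; left.
have toX := cyclic_subgroup_expg N_gt0 delta_order.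
(* Both inclusions serve: delta is the conjugate of some delta^n, which makes S x and S y
   eigenvectors of D; and the conjugate of delta is some delta^m, which makes T x invariant. *)
have [c /toX[n cE] cg] : ((fun a => a ^ g)%g @` cyclic_subgroup delta) delta.
  by rewrite Hg.
have /toX[m dg] : cyclic_subgroup delta (delta ^ g)%g.
  by rewrite -Hg; exists delta.
have cg_eq : (c * g = g * delta)%g by rewrite conjgC cg.
have dg_eq : (delta * g = g * delta ^+ m)%g by rewrite -dg -conjgC.
have [S SP] := pullback g; have [T TP] := pullback (g^-1)%g.
have [D DP] := pullback delta; have [C CP] := pullback c.
have [E EP] := pullback (delta ^+ m)%g.
have [Dx Dy] := (pullback_diag 1 xi DP).1 delta_diag.
rewrite rmorph1 mul1r in Dx.
have := (pullback_diag _ _ CP).1 _ => /(_ (1 ^+ n) (xi ^+ n)).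
rewrite cE => /(_ (diagonalX n delta_diag)); rewrite expr1n rmorph1 mul1r.
move=> [Cx Cy].
have [Ex _] := (pullback_diag _ _ EP).1 (diagonalX m delta_diag).
rewrite expr1n rmorph1 mul1r in Ex.
have ST z : S (T z) = z.
  have := pullback_comp TP SP; rewrite mulVg => STP.
  have id_P : is_pullback (1%g : superelliptic_aut j) (@idfun K) by [].
  exact: (pullback_eq cof inf z STP id_P).
have TS z : T (S z) = z.
  have := pullback_comp SP TP; rewrite mulgV => TSP.
  have id_P : is_pullback (1%g : superelliptic_aut j) (@idfun K) by [].
  exact: (pullback_eq cof inf z TSP id_P).
have SC z : S (C z) = D (S z).
  have := pullback_comp CP SP; rewrite cg_eq => SCP.
  exact: (pullback_eq cof inf z SCP (pullback_comp SP DP)).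
have SD z : S (D z) = E (S z).
  have := pullback_comp DP SP; rewrite dg_eq => SDP.
  exact: (pullback_eq cof inf z SDP (pullback_comp SP EP)).
have S_iota c' := pull_iota c' SP.
have D_iota c' := pull_iota c' DP.
have DSx : D (S x) = iota (xi ^+ 0) * S x by rewrite expr0 rmorph1 mul1r -SC Cx.
have DTx : D (T x) = iota (xi ^+ 0) * T x.
  by rewrite expr0 rmorph1 mul1r -[LHS]TS SD ST Ex.
pose i := (n %% N)%N; have i_lt : (i < N)%N by rewrite ltn_mod.
have DSy : D (S y) = iota (xi ^+ i) * S y.
  by rewrite -SC Cy rmorphM S_iota (prim_expr_mod xi_prim).
have eig := eigenvector N_gt4 K_frac xi_prim D_iota Dx Dy.
have [p1 [q1 [q10 Sx]]] := eig _ _ N_gt0 DSx.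
have [u1 [v1 [v10 Tx]]] := eig _ _ N_gt0 DTx.
have [r [s [s0 Sy]]] := eig _ _ i_lt DSy.
rewrite expr0 mulr1 in Sx; rewrite expr0 mulr1 in Tx.
have [p [q [pq q0 pqE]]] := coprime_fctx_fraction p1 q10.
have [u [v [uv v0 uvE]]] := coprime_fctx_fraction u1 v10.
rewrite {}pqE in Sx; rewrite {}uvE in Tx.
have STx : S (fctx u / fctx v) = x by rewrite -Tx ST.
have [sp sq] := invertible_degree N_gt4 K_frac S_iota pq q0 uv v0 Sx STx.
have r0 : r != 0.
  apply: contraTneq isT => r0; have : S y != 0.
    by rewrite fmorph_eq0 coord_y_neq0.
  by rewrite Sy r0 rmorph0 !mul0r eqxx.
(* If L were constant, x would be constant too, by injectivity of S. *)
have pq_gt1 : (1 < size p)%N || (1 < size q)%N.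
  apply: contraT; rewrite negb_or -!leqNgt => /andP[/size1_polyC pE /size1_polyC qE].
  have : x = iota (p`_0 / q`_0).
    apply: (fmorph_inj S); rewrite S_iota Sx pE qE !fctxC // !coefC /=.
    by rewrite fmorph_div.
  rewrite -(fctxX j N_gt4) -(fctxC j N_gt4) => /(fctx_inj N_gt4 K_frac).
  move/(congr1 (fun p : {poly k} => size p)); rewrite size_polyX => e.
  by have := size_polyC_leq1 (p`_0 / q`_0); rewrite -e.
have [a [b [a0 bN [Sx' Sy'] HB HC]]] := semilinear_diagonal N_gt4 K_frac f_neq0
  rs_uniq rs_size f_split f_eq three_unit S_iota pq q0 r0 s0 sp sq pq_gt1 i_lt Sx Sy.
by exists a, b; split=> //; apply/(pullback_diag a b SP).
Qed.

(** Each case of the theorem is thereby reduced to arithmetic of pairs (a, b): the order of (a0,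
    b0), and that its powers exhaust the solutions. The powers of s normalize because diagonal
    automorphisms commute. *)
Lemma normalizer_cyclic a0 b0 n (s : superelliptic_aut j) :
  diagonal_action a0 b0 s -> (1 < n)%N ->
  (forall m, a0 ^+ m = 1 /\ b0 ^+ m = 1 <-> (n %| m)%N) ->
  (forall a b, a != 0 -> b ^+ N = a ^+ 3 -> B0 * a = a ^+ 3 * B0 ->
     C0 = a ^+ 3 * C0 -> exists m, a = a0 ^+ m /\ b = b0 ^+ m) ->
  normalizer (cyclic_subgroup delta) = cyclic_subgroup s /\
  isom_Zmod n (normalizer (cyclic_subgroup delta)).
Proof.
move=> s_diag n_gt1 ord_s gen_s.
have HE : normalizer (cyclic_subgroup delta) = cyclic_subgroup s.
  apply/seteqP; split=> [g /normalizer_diagonal[a [b [ab ? ? ? ?]]]|g].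
    have [//|//|//|//|m [aE bE]] := gen_s a b.
    exists m; left; apply: diag_unique ab _.
    by rewrite aE bE; apply: diagonalX.
  have cs : commute delta s.
    apply: diag_unique (diagonal_mul delta_diag s_diag) _.
    by rewrite [1 * _]mulrC [xi * _]mulrC; apply: diagonal_mul.
  move=> [m [->|->]]; apply: commute_normalizer; apply/commute_sym.
    exact: commuteX.
  by apply/commuteV/commuteX.
split=> //; rewrite HE; apply: isom_cyclic => // m.
have diag_sm := diagonalX m s_diag.
rewrite -ord_s; split=> [sm1|[am bm]].
  rewrite sm1 in diag_sm.
  have [<- <-] := diagonal_inj N_gt0 K_frac f_neq0 Nm_coprime f_sep N_unit
    (@diagonal1 _ _ _ _ j) diag_sm.
  by [].
by apply: diag_unique diag_sm _; rewrite am bm; apply: diagonal1.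
Qed.

End Normalizer.

Lemma separable_mup (k : fieldType) (f : {poly k}) c : f != 0 ->
  (mup c f <= 1)%N -> root f c -> ~~ root f^`() c.
Proof.
move=> f0; rewrite mup_leq // => ndvd fc; apply: contra ndvd => f'c.
have [g gE] := factor_theorem _ _ fc.
have : root g c.
  move: f'c; rewrite gE derivM derivXsubC mulr1 !rootE !hornerE subrr mulr0 add0r.
  by [].
case/factor_theorem=> g' g'E; apply/dvdpP; exists g'.
by rewrite gE g'E -mulrA.
Qed.

Lemma cubic_comp_scale (k : fieldType) (a B0 C0 : k) :
  B0 * a = a ^+ 3 * B0 -> C0 = a ^+ 3 * C0 ->
  ('X^3 + B0 *: 'X + C0%:P) \Po (a *: 'X) = a ^+ 3 *: ('X^3 + B0 *: 'X + C0%:P).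
Proof.
move=> HB HC; rewrite !comp_polyD comp_polyZ comp_polyC comp_Xn_poly comp_polyX.
rewrite !scalerDr exprZn !scalerA HB; congr (_ + _).
by rewrite -[RHS]mul_polyC -polyCM -HC.
Qed.

Theorem theorem4p4 (k : closedFieldType) (char0 : [pchar k] =i pred0)
  (f : {poly k}) (B0 C0 : k)
  (f_monic : f \is monic) (f_deg : size f = 4%N)
  (f_simple : forall a : k, (mup a f <= 1)%N)
  (f_eq : f = 'X^3 + B0 *: 'X + C0%:P)
  (N : nat) (N_gt1 : (1 < N)%N) (N_coprime : coprime N 3)
  (N_neq2 : (N != 2)%N) (N_neq4 : (N != 4)%N)
  (xi2N : k) (xi2N_prim : (2 * N)%N.-primitive_root xi2N)
  (omega : k) (omega_prim : 3.-primitive_root omega)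
  (K : fieldType) (j : {rmorphism coordinate_ring f N -> K})
  (K_frac : is_fraction_field j) :
  let xiN := xi2N ^+ 2 in
  exists delta : superelliptic_aut j,
    unique (diagonal_action 1 xiN) delta /\
    let H := normalizer (cyclic_subgroup delta) in
    [/\ B0 * C0 != 0 ->
          H = cyclic_subgroup delta /\ isom_Zmod N H,
        B0 = 0 -> C0 != 0 ->
          exists s : superelliptic_aut j,
            [/\ unique (diagonal_action omega xiN) s,
                H = cyclic_subgroup s & isom_Zmod (3 * N)%N H]
      & B0 != 0 -> C0 = 0 ->
          exists s : superelliptic_aut j,
            [/\ unique (diagonal_action (-1) xi2N) s,
                H = cyclic_subgroup s & isom_Zmod (2 * N)%N H]].
Proof.
have f0 : f != 0 by rewrite monic_neq0.
have nat0 := (pcharf0P k).1 char0.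
have N_gt0 : (0 < N)%N by apply: ltnW.
have N_gt4 : (4 < N)%N.
  move: N_gt1 N_coprime N_neq2 N_neq4; clear.
  by case: N => [|[|[|[|[|n]]]]].
have N_unit : N%:R != 0 :> k by rewrite nat0 -lt0n.
have three_unit : 3%:R != 0 :> k by rewrite nat0.
have Nm : coprime N (size f).-1 by rewrite f_deg.
have f_sep c : root f c -> ~~ root f^`() c by apply: separable_mup.
have [rs f_split] := closed_field_poly_normal f.
rewrite (monicP f_monic) scale1r in f_split.
have rs_size : size rs = 3%N.
  by have := f_deg; rewrite f_split size_prod_XsubC => -[].
have rs_uniq : uniq rs.
  apply: count_mem_uniq => e; have := f_simple e; rewrite f_split mu_prod_XsubC.
  by rewrite -has_pred1 has_count; case: (count_mem e rs) => [|[]].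
move=> xiN.
have xiN_prim : N.-primitive_root xiN.
  by have := exp_prim_root xi2N_prim 2; rewrite (gcdn_idPl (dvdn_mulr _ _)) // mulKn.
have xiN0 : xiN != 0 by rewrite (prim_root_eq0 xiN_prim) -lt0n.
have xi0 : xi2N != 0.
  by rewrite (prim_root_eq0 xi2N_prim) muln_eq0 -lt0n.
have xi2N_N : xi2N ^+ N = -1.
  have /eqP : (xi2N ^+ N) ^+ 2 = 1 by rewrite -exprM mulnC (prim_expr_order xi2N_prim).
  rewrite sqrf_eq1 => /orP[|/eqP//]; rewrite -(prim_order_dvd xi2N_prim).
  by move/(dvdn_leq N_gt0); rewrite mul2n -addnn -{3}[N]addn0 leq_add2l leqNgt N_gt0.
have aut a b : a != 0 -> b != 0 -> b ^+ N = a ^+ 3 -> B0 * a = a ^+ 3 * B0 ->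
    C0 = a ^+ 3 * C0 ->
    exists s : superelliptic_aut j, unique (diagonal_action a b) s.
  move=> a0 b0 bN HB HC.
  have [s s_diag] : exists s : superelliptic_aut j, diagonal_action a b s.
    apply: (diagonal_exists N_gt0 K_frac f0 Nm f_sep N_unit a0 b0).
    by rewrite bN f_eq; apply: cubic_comp_scale.
  exists s; split=> // t; exact: diagonal_unique s_diag.
have [delta [delta_diag delta_uniq]] : exists s : superelliptic_aut j,
    unique (diagonal_action 1 xiN) s.
  by apply: aut; rewrite ?oner_eq0 ?(prim_expr_order xiN_prim) ?expr1n ?mulr1 ?mul1r.
exists delta; split=> // H.
have gen a b n s := normalizer_cyclic N_gt4 K_frac f0 Nm f_sep N_unit rs_uniq rs_size
  f_split f_eq three_unit xiN_prim delta_diag (a0 := a) (b0 := b) (n := n) (s := s).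
split.
- rewrite mulf_eq0 negb_or => /andP[B00 C00].
  apply: (gen _ _ _ _ delta_diag N_gt1) => [m|a b a0 bN HB HC].
    by rewrite expr1n (prim_order_dvd xiN_prim); split=> [[_ ->]|/eqP].
  have a3 : a ^+ 3 = 1 by apply: (mulIf C00); rewrite mul1r -HC.
  have a1 : a = 1 by apply: (mulfI B00); rewrite HB a3 mul1r mulr1.
  rewrite a3 in bN; have [i ->] := prim_rootP xiN_prim bN.
  by exists i; rewrite expr1n.
- move=> B00 C00; have omega3 := prim_expr_order omega_prim.
  have omega0 : omega != 0 by rewrite (prim_root_eq0 omega_prim).
  have [s [s_diag s_uniq]] : exists s : superelliptic_aut j,
      unique (diagonal_action omega xiN) s.
    by apply: aut; rewrite // ?(prim_expr_order xiN_prim) omega3 ?B00 ?mul1r ?mul0r ?mulr0.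
  exists s; have [|m|a b a0 bN _ HC|HE HZ] := gen _ _ (3 * N)%N _ s_diag; last by [].
  + by rewrite (leq_trans N_gt1) // leq_pmull.
  + rewrite Gauss_dvd 1?coprime_sym // (prim_order_dvd omega_prim).
    rewrite (prim_order_dvd xiN_prim).
    by split=> [[-> ->]|/andP[/eqP-> /eqP->]]; rewrite ?eqxx.
  have a3 : a ^+ 3 = 1 by apply: (mulIf C00); rewrite mul1r -HC.
  rewrite a3 in bN; have [v ->] := prim_rootP xiN_prim bN.
  have [u ->] := prim_rootP omega_prim a3.
  have co3N : coprime 3 N by rewrite coprime_sym.
  (* The exponents of omega and of the N-th root of unity matter only modulo 3 and N, which are
     coprime. *)
  exists (chinese 3 N u v); split.
    rewrite -[RHS](prim_expr_mod omega_prim) (chinese_modl co3N).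
    by rewrite (prim_expr_mod omega_prim).
  rewrite -[RHS](prim_expr_mod xiN_prim) (chinese_modr co3N).
  by rewrite (prim_expr_mod xiN_prim).
move=> B00 C00.
have m13 : (-1) ^+ 3 = -1 :> k by rewrite exprS sqrrN expr1n mulr1.
have [s [s_diag s_uniq]] : exists s : superelliptic_aut j,
    unique (diagonal_action (-1) xi2N) s.
  by apply: aut; rewrite ?oppr_eq0 ?oner_eq0 // m13 ?C00 ?mulr0 // mulrC.
exists s; have [|m|a b a0 bN HB _|HE HZ] := gen _ _ (2 * N)%N _ s_diag; last by [].
- by rewrite (leq_trans N_gt1) // leq_pmull.
- rewrite (prim_order_dvd xi2N_prim); split=> [[_ ->]//|/eqP xm]; split=> //.
  by rewrite -xi2N_N -exprM mulnC exprM xm expr1n.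
have a3 : a ^+ 3 = a by apply: (mulIf B00); rewrite -HB mulrC.
have a2 : a ^+ 2 = 1 by apply: (mulfI a0); rewrite -exprS a3 mulr1.
(* So b is a power of [xi2N], and it determines a = a^3 = b^N. As [xi2N ^+ N = -1], one exponent
   serves both coordinates. *)
have : b ^+ (2 * N) = 1 by rewrite mulnC exprM bN a3.
move/(prim_rootP xi2N_prim)=> [v bE]; exists v; split=> //.
by rewrite -a3 -bN bE -exprM mulnC exprM xi2N_N.
Qed.
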